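(* Let $f:\mathbb R^d\to\mathbb R$ be locally Lipschitz, let $\bar x$ be a local minimizer of $f$, and suppose $f$ is properly $C^4$ decomposable at $\bar x$. Suppose furthermore that 1. (strict complementarity) $0\in\operatorname{ri}\partial f(\bar x)$; 2. (quadratic growth) there exists $\gamma>0$ such that $f(x)-f(\bar x)\ge\frac\gamma2\|x-\bar x\|^2$ for all $x$ near $\bar x$. Then $f$ is typical at $\bar x$ (see context).
   Context: A function $h:\mathbb R^m\to\mathbb R$ is sublinear if its epigraph is a closed convex cone; $\operatorname{Lin}(h)=\{x:h(x)=-h(-x)\}$. A function $f:\mathbb R^d\to\mathbb R$ is properly $C^p$ decomposable at $\bar x$ if near $\bar x$ it can be written $f(x)=f(\bar x)+h(c(x))$ for some $C^p$ map $c:\mathbb R^d\to\mathbb R^m$ with $c(\bar x)=0$ and some proper closed sublinear function $h:\mathbb R^m\to\mathbb R$ with $\operatorname{Lin}(h)+\operatorname{range}(\nabla c(\bar x))=\mathbb R^m$. $\operatorname{ri}$ denotes relative interior. Notation: $\|\cdot\|$ is the Euclidean norm; $P_X$ is the orthogonal projection onto $X$. For locally Lipschitz $f$, $\partial f(x)$ is the Clarke subdifferential: the convex hull of all limits $\lim_i\nabla f(x_i)$ with $x_i\to x$ and $f$ differentiable at each $x_i$. Manifolds: $\mathcal M$ is a $C^p$ manifold around $\bar x$ if $\mathcal M\cap U=F^{-1}(0)$ for an open neighborhood $U$ of $\bar x$ and a $C^p$ map $F:U\to\mathbb R^m$ with surjective Jacobian; $T_{\mathcal M}(x)=\ker\nabla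 F(x)$. A function is $C^q$ on $\mathcal M$ near a point if it agrees on $\mathcal M$ near that point with a $C^q$ function $\hat f$ defined on an open set; the covariant gradient is $\nabla_{\mathcal M}f(x)=P_{T_{\mathcal M}(x)}(\nabla\hat f(x))$ (independent of $\hat f$). Let $0\in\partial f(\bar x)$ and $\bar x\in\mathcal M$. $\mathcal M$ is an active $C^p$ manifold for $f$ around $\bar x$ if $\mathcal M$ is a $C^p$ manifold around $\bar x$, $f|_{\mathcal M}$ is $C^p$ near $\bar x$, and $\inf\{\|v\|:v\in\partial f(x),x\in U\setminus\mathcal M\}>0$ for some neighborhood $U$ of $\bar x$. ''$f$ is typical at $\bar x$'' means: $f$ is locally Lipschitz with local minimizer $\bar x$, and (A1) there is $\gamma>0$ with $f(x)-f(\bar x)\ge\frac\gamma2\|x-\bar x\|^2$ for all $x$ near $\bar x$; (A2) $f$ admits a $C^4$ active manifold $\mathcal M$ around $\bar x$; (A3) there is $C_{(a)}>0$ with $\|P_{T_{\mathcal M}(y)}(v-\nabla_{\mathcal M}f(y))\|\le C_{(a)}\|x-y\|$ for all $x\in\mathbb R^d$, $v\in\partial f(x)$, $y\in\mathcal M$ near $\bar x$; (A4) $f(y)\ge f(x)+\langle v,y-x\rangle+o(\|y-x\|)$ as $y\to\bar x$ within $\mathcal M$ and $x\to\bar x$ with $v\in\partial f(x)$, where $o(\cdot)$ is a univariate function with $\lim_{t\to0}o(t)/t=0$. *)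

(* Defs.v *)
From HB Require Import structures.
From mathcomp Require Import all_boot all_order all_algebra.
From mathcomp Require Import all_classical all_reals all_analysis.

Set Implicit Arguments.
Unset Strict Implicit.
Unset Printing Implicit Defensive.
Import Order.TTheory GRing.Theory Num.Theory.
Import numFieldNormedType.Exports.

Local Open Scope classical_set_scope.
Local Open Scope ring_scope.

(* R^n is 'rV[R]_n. The library norm `|x| on 'rV[R]_n is the sup norm; it
   induces the same topology, differentials and locally Lipschitz functions as
   the Euclidean norm, which is [enorm] below and is the one used in every
   quantitative estimate. *)

Section Euclidean.
Context {R : realType} {n : nat}.
Implicit Types (u v : 'rV[R]_n) (X : set 'rV[R]_n).

Definition dot u v : R := \sum_(i < n) u 0 i * v 0 i.

Definition enorm v : R := Num.sqrt (dot v v).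

(* Only meaningful when X is a linear subspace. *)
Definition orth_proj X v : 'rV[R]_n :=
  get [set u | X u /\ forall w, X w -> dot (v - u) w = 0].

Definition gradient (f : 'rV[R]_n -> R^o) (x : 'rV[R]_n) : 'rV[R]_n :=
  \row_(i < n) 'd f x (delta_mx 0 i).

End Euclidean.

Section Smoothness.
Context {R : realType} {n : nat} {W : normedModType R}.

(* C^p regularity on an open set U. As the domain is finite dimensional, the
   derivative is C^p iff x |-> 'd f x v is C^p for every fixed vector v. The
   values of f outside U are irrelevant. *)
Fixpoint Cp (p : nat) (U : set 'rV[R]_n) (f : 'rV[R]_n -> W) : Prop :=
  if p is q.+1 then
    (forall x, U x -> differentiable f x) /\
    (forall v, Cp q U (fun x => 'd f x v))
  else forall x, U x -> {for x, continuous f}.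

Definition locally_lipschitz (f : 'rV[R]_n -> W) : Prop :=
  forall x : 'rV[R]_n, exists2 U, nbhs x U & [lipschitz f y | y in U].

End Smoothness.

Section Convexity.
Context {R : realType} {n : nat}.
Implicit Types A : set 'rV[R]_n.

Definition convex_hull A : set 'rV[R]_n :=
  smallest (@convex_set R 'rV[R]_n) A.

Definition affine_set A : Prop :=
  forall x y (t : R), A x -> A y -> A (t *: x + (1 - t) *: y).

Definition affine_hull A : set 'rV[R]_n := smallest affine_set A.

Definition relative_interior A : set 'rV[R]_n :=
  [set x | A x /\ \forall y \near x, affine_hull A y -> A y].

Definition epigraph (h : 'rV[R]_n -> R) : set ('rV[R]_n * R^o) :=
  [set z | h z.1 <= z.2].

Definition cone (E : lmodType R) (K : set E) : Prop :=
  forall (t : R) z, 0 < t -> K z -> K (t *: z).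

(* Real-valued functions are proper, and closedness of h is closedness of its
   epigraph, so this covers "proper closed sublinear". *)
Definition sublinear (h : 'rV[R]_n -> R) : Prop :=
  [/\ closed (epigraph h),
      @convex_set R ('rV[R]_n * R^o)%type (epigraph h) &
      cone (epigraph h)].

Definition Lin (h : 'rV[R]_n -> R) : set 'rV[R]_n :=
  [set x | h x = - h (- x)].

End Convexity.

Section Nonsmooth.
Context {R : realType} {d : nat}.
Implicit Types (f : 'rV[R]_d -> R^o) (M U : set 'rV[R]_d) (x xbar : 'rV[R]_d).

Definition limiting_gradients f x : set 'rV[R]_d :=
  [set g | exists u : nat -> 'rV[R]_d,
    [/\ u @ \oo --> x,
        forall i, differentiable f (u i) &
        (fun i => gradient f (u i)) @ \oo --> g]].

Definition clarke f x : set 'rV[R]_d := convex_hull (limiting_gradients f x).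

Definition local_minimizer f x : Prop := \forall y \near x, f x <= f y.

Definition quadratic_growth f x : Prop :=
  exists2 gamma : R, 0 < gamma &
    \forall y \near x, gamma / 2 * enorm (y - x) ^+ 2 <= f y - f x.

Definition properly_decomposable (p : nat) f x : Prop :=
  exists (m : nat) (c : 'rV[R]_d -> 'rV[R]_m) (h : 'rV[R]_m -> R),
    [/\ Cp p setT c, c x = 0, sublinear h,
        \forall y \near x, f y = f x + h (c y) &
        [set u + w | u in Lin h & w in range ('d c x)] = [set: 'rV[R]_m]].

Definition defining_map (p : nat) M x (m : nat) U (F : 'rV[R]_d -> 'rV[R]_m) :
    Prop :=
  [/\ open U, U x, Cp p U F,
      forall y, U y -> range ('d F y) = [set: 'rV[R]_m] &
      M `&` U = [set y | U y /\ F y = 0]].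

Definition manifold_around (p : nat) M x : Prop :=
  exists m U (F : 'rV[R]_d -> 'rV[R]_m), defining_map p M x U F.

(* For x in M, all defining maps of M around x give the same kernel. *)
Definition tangent_space (p : nat) M x : set 'rV[R]_d :=
  [set v | exists m U (F : 'rV[R]_d -> 'rV[R]_m),
    defining_map p M x U F /\ 'd F x v = 0].

Definition smooth_extension (q : nat) M f x U (fhat : 'rV[R]_d -> R^o) : Prop :=
  [/\ open U, U x, Cp q U fhat & forall y, M y -> U y -> f y = fhat y].

Definition smooth_on_near (q : nat) M f x : Prop :=
  exists U fhat, smooth_extension q M f x U fhat.

(* The set below is a singleton when M is a C^p manifold around x in M and f is
   C^p on M near x, with p >= 1. *)
Definition covariant_gradient (p : nat) M f x : 'rV[R]_d :=
  get [set g | exists U fhat, smooth_extension p M f x U fhat /\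
    g = orth_proj (tangent_space p M x) (gradient fhat x)].

(* The infimum is taken in \bar R, so that it is +oo when U is contained in M
   (as for smooth f, with M a neighborhood of x). *)
Definition active_manifold (p : nat) M f x : Prop :=
  [/\ clarke f x 0, M x, manifold_around p M x, smooth_on_near p M f x &
      exists2 U, nbhs x U &
        (0 < ereal_inf
          [set (enorm v)%:E | v in \bigcup_(y in U `\` M) clarke f y])%E].

Definition strong_a (p : nat) M f xbar : Prop :=
  exists2 C : R, 0 < C &
    \forall x \near xbar & y \near xbar, forall v, clarke f x v -> M y ->
      enorm (orth_proj (tangent_space p M y) (v - covariant_gradient p M f y))
        <= C * enorm (x - y).

Definition b_le_regular M f xbar : Prop :=
  exists2 o : R -> R, o t / t @[t --> 0^'] --> 0 &
    \forall x \near xbar & y \near xbar, forall v, clarke f x v -> M y ->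
      f x + dot v (y - x) + o (enorm (y - x)) <= f y.

Definition typical f xbar : Prop :=
  [/\ locally_lipschitz f, local_minimizer f xbar, quadratic_growth f xbar &
      exists M, [/\ active_manifold 4 M f xbar, strong_a 4 M f xbar &
                    b_le_regular M f xbar]].

End Nonsmooth.

(* Main.v *)
(** Near [xbar] write [f = f xbar + h \o c].  The active manifold is
    [M = {x | c x \in Lin h}]; on it [h] is linear, so [f] is smooth there.

    Every Clarke subgradient [q] of [f] at [x] satisfies
    [dot q v <= h (c x + 'd c x v) - h (c x)] for all [v]: this holds at points
    of differentiability because [h] is convex, and it survives limits and
    convex combinations.  (A4) follows by Taylor expansion of [c], and (A3) by
    taking [v] tangent to [M] at [y], where [h ('d c y v)] is the derivative of
    the smooth extension of [f].  For (A2), take [v] with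
    [c x + 'd c x v \in Lin h]: then [- dot q v >= h (- 'd c x v)], and the
    right-hand side is at least a multiple of [`|v|] as soon as
    [0 < h ('d c xbar w)] whenever ['d c xbar w] is not in [Lin h].

    That last fact comes from strict complementarity: if it fails for [w], then
    [0 < h ('d c xbar (- w))], so some Clarke subgradient [q] has
    [dot q w < 0]; as [- t *: q] is also a subgradient for small [t], we get
    [0 < - t * dot q w <= h ('d c xbar w) <= 0].  To produce [q] without
    Rademacher's theorem, maximize [f (xbar + t *: z)] minus a steep quadratic
    centred at [- w]: at the maximizer [f] lies below a smooth function and
    above a convex model with the same value, hence is differentiable. *)

Require Import Defs.
From HB Require Import structures.
From mathcomp Require Import all_boot all_order all_algebra.
From mathcomp Require Import all_classical all_reals all_analysis.
From mathcomp Require Import ring lra.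
Import Order.TTheory GRing.Theory Num.Theory.
Import numFieldNormedType.Exports.

Set Implicit Arguments.
Unset Strict Implicit.
Unset Printing Implicit Defensive.

Local Open Scope classical_set_scope.
Local Open Scope ring_scope.

(** * Vectors, differentials and Taylor bounds *)

Section Vectors.
Context {R : realType}.

Lemma nbhs_ballE {V : normedModType R} (x : V) (P : set V) :
  (\forall y \near x, P y) <->
  exists2 r : R, 0 < r & forall y, `|y - x| < r -> P y.
Proof.
split=> [/nbhs_normP[r /= r0 rP]|[r r0 rP]].
  by exists r => // y yr; apply: rP; rewrite /= distrC.
by apply/nbhs_normP; exists r => // y /=; rewrite distrC => /rP.
Qed.

Lemma near_in_ball {V : normedModType R} (x x0 : V) r :
  `|x - x0| < r -> \forall y \near x, `|y - x0| < r.
Proof.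
move=> xr; apply/nbhs_ballE; exists (r - `|x - x0|); rewrite ?subr_gt0 // => y.
have -> : y - x0 = (y - x) + (x - x0) by rewrite addrA subrK.
by rewrite ltrBrDr; apply: le_lt_trans (ler_normD _ _).
Qed.

Lemma segment_in_ball {V : normedModType R} (x y x0 : V) r (s : R) :
  `|x - x0| < r -> `|y - x0| < r -> 0 <= s <= 1 ->
  `|x + s *: (y - x) - x0| < r.
Proof.
move=> xr yr /andP[s0 s1].
have -> : x + s *: (y - x) - x0 = s *: (y - x0) + (1 - s) *: (x - x0).
  have -> : y - x = (y - x0) - (x - x0) by rewrite opprB addrA subrK.
  by rewrite addrAC scalerBr scalerBl scale1r addrCA.
apply: le_lt_trans (ler_normD _ _) _.
rewrite !normrZ !ger0_norm ?subr_ge0 //.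
have : s * `|y - x0| <= s * r by rewrite ler_wpM2l // ltW.
have : (1 - s) * `|x - x0| <= (1 - s) * r by rewrite ler_wpM2l ?subr_ge0 // ltW.
have [->|s_neq0] := eqVneq s 0; first by lra.
have : s * `|y - x0| < s * r by rewrite ltr_pM2l // lt_def s_neq0.
by lra.
Qed.

Lemma near_forall {V : normedModType R} (I : finType) (P : I -> set V) (x : V) :
  (forall i, \forall y \near x, P i y) -> \forall y \near x, forall i, P i y.
Proof. exact: (@filter_forall _ _ P (nbhs x)). Qed.

Lemma continuous_eps {V W : normedModType R} (g : V -> W) x :
  (forall e, 0 < e -> exists2 s : R, 0 < s &
    forall y, `|y - x| < s -> `|g y - g x| < e) ->
  {for x, continuous g}.
Proof.
move=> gx; apply/(@cvgrPdist_lt _ _ _ (nbhs x)) => e /gx gxe.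
apply/nbhs_ballE; case: gxe => s s0 sP; exists s => // y /sP.
by rewrite distrC.
Qed.

Lemma coord_le_norm n (v : 'rV[R]_n) i : `|v 0 i| <= `|v|.
Proof.
rewrite -[leRHS]/(mx_norm v) mx_normrE; apply/bigmax_geP; right => /=.
by exists (0, i).
Qed.

Lemma norm_le_coord n (v : 'rV[R]_n) M :
  0 <= M -> (forall i, `|v 0 i| <= M) -> `|v| <= M.
Proof.
move=> M0 vM; rewrite -[leLHS]/(mx_norm v) mx_normrE; apply/bigmax_leP.
by split=> // -[i j] _ /=; rewrite (ord1 i).
Qed.

Lemma linear_norm_le n (W : normedModType R) (g : {linear 'rV[R]_n -> W}) v :
  `|g v| <= (\sum_i `|g (delta_mx 0 i)|) * `|v|.
Proof.
rewrite {1}(row_sum_delta v) linear_sum mulr_suml.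
apply: le_trans (ler_norm_sum _ _ _) _; apply: ler_sum => i _.
by rewrite linearZ /= normrZ mulrC ler_wpM2l // coord_le_norm.
Qed.

Lemma linear_rV_continuous n (W : normedModType R)
  (g : {linear 'rV[R]_n -> W}) : continuous g.
Proof.
apply: bounded_linear_continuous; apply/bounded_funP => r.
exists ((\sum_i `|g (delta_mx 0 i)|) * r) => x xr.
apply: le_trans (linear_norm_le g x) _.
by rewrite ler_wpM2l // sumr_ge0.
Qed.

Lemma mulmx_norm_le m n (A : 'M[R]_(m, n)) :
  exists2 a : R, 0 < a & forall v : 'rV_m, `|v *m A| <= a * `|v|.
Proof.
exists (1 + \sum_i `|delta_mx (0 : 'I_1) i *m A|).
  by rewrite ltr_pwDl // sumr_ge0.
move=> v; apply: le_trans (linear_norm_le (mulmxr A) v) _.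
by rewrite ler_wpM2r // lerDr.
Qed.

Lemma dotDl n (u v w : 'rV[R]_n) : dot (u + v) w = dot u w + dot v w.
Proof. by rewrite -big_split; apply: eq_bigr => i _; rewrite mxE mulrDl. Qed.

Lemma dotC n (u v : 'rV[R]_n) : dot u v = dot v u.
Proof. by apply: eq_bigr => i _; rewrite mulrC. Qed.

Lemma dotZl n a (u v : 'rV[R]_n) : dot (a *: u) v = a * dot u v.
Proof. by rewrite mulr_sumr; apply: eq_bigr => i _; rewrite mxE mulrA. Qed.

Lemma dotDr n (u v w : 'rV[R]_n) : dot u (v + w) = dot u v + dot u w.
Proof. by rewrite dotC dotDl ![dot _ u]dotC. Qed.

Lemma dotZr n a (u v : 'rV[R]_n) : dot u (a *: v) = a * dot u v.
Proof. by rewrite dotC dotZl dotC. Qed.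

Lemma dotNl n (u v : 'rV[R]_n) : dot (- u) v = - dot u v.
Proof. by rewrite -scaleN1r dotZl mulN1r. Qed.

Lemma dotNr n (u v : 'rV[R]_n) : dot u (- v) = - dot u v.
Proof. by rewrite dotC dotNl dotC. Qed.

Lemma dotBl n (u v w : 'rV[R]_n) : dot (u - v) w = dot u w - dot v w.
Proof. by rewrite dotDl dotNl. Qed.

Lemma dotBr n (u v w : 'rV[R]_n) : dot u (v - w) = dot u v - dot u w.
Proof. by rewrite dotDr dotNr. Qed.

Lemma dot0l n (v : 'rV[R]_n) : dot 0 v = 0.
Proof. by rewrite /dot big1 // => i _; rewrite mxE mul0r. Qed.

Lemma dot_norm_le n (u v : 'rV[R]_n) : `|dot u v| <= n%:R * `|u| * `|v|.
Proof.
apply: le_trans (ler_norm_sum _ _ _) _.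
rewrite -mulrA -[n in n%:R]card_ord -sum1_card natr_sum mulr_suml.
apply: ler_sum => i _.
by rewrite mul1r normrM ler_pM // coord_le_norm.
Qed.

Lemma dot_ge0 n (v : 'rV[R]_n) : 0 <= dot v v.
Proof. by apply: sumr_ge0 => i _; rewrite -expr2 sqr_ge0. Qed.

Lemma norm_sqr_le_dot n (v : 'rV[R]_n) : `|v| ^+ 2 <= dot v v.
Proof.
rewrite -[leRHS]sqr_sqrtr ?dot_ge0 // ler_pXn2r ?nnegrE ?sqrtr_ge0 //.
apply: norm_le_coord => [|i]; first exact: sqrtr_ge0.
rewrite -sqrtr_sqr ler_sqrt ?dot_ge0 // /dot (bigD1 i) //= -expr2 lerDl.
by apply: sumr_ge0 => j _; rewrite -expr2 sqr_ge0.
Qed.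

Lemma enorm_ge0 n (v : 'rV[R]_n) : 0 <= enorm v.
Proof. exact: sqrtr_ge0. Qed.

Lemma sqr_enorm n (v : 'rV[R]_n) : enorm v ^+ 2 = dot v v.
Proof. exact/sqr_sqrtr/dot_ge0. Qed.

Lemma norm_le_enorm n (v : 'rV[R]_n) : `|v| <= enorm v.
Proof.
by rewrite -(@ler_pXn2r _ 2) ?nnegrE ?enorm_ge0 // sqr_enorm norm_sqr_le_dot.
Qed.

Lemma dot_gradient n (f : 'rV[R]_n -> R^o) x v :
  dot (gradient f x) v = 'd f x v.
Proof.
rewrite [in RHS](row_sum_delta v) linear_sum; apply: eq_bigr => i _.
by rewrite linearZ /= mxE mulrC.
Qed.

Lemma dot_linear n (v : 'rV[R]_n) : linear (dot v : 'rV[R]_n -> R^o).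
Proof. by move=> a u w; rewrite dotDr dotZr. Qed.

HB.instance Definition _ n (v : 'rV[R]_n) :=
  GRing.isLinear.Build R 'rV[R]_n R^o *:%R (dot v) (@dot_linear n v).

Lemma dot_inj n (u v : 'rV[R]_n) : (forall w, dot u w = dot v w) -> u = v.
Proof.
move=> uv; apply/eqP; rewrite -subr_eq0 -normr_eq0 eq_le normr_ge0 andbT.
rewrite -(@ler_pXn2r _ 2) ?nnegrE // expr0n /=.
by apply: le_trans (norm_sqr_le_dot _) _; rewrite dotBl uv subrr.
Qed.

End Vectors.

Section Differentials.
Context {R : realType}.

Lemma differentiable_eps {V W : normedModType R} (f : V -> W) x e :
  differentiable f x -> 0 < e ->
  \forall y \near x, `|f y - f x - 'd f x (y - x)| <= e * `|y - x|.
Proof.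
move=> /diff_locally/eqaddoP fx e0; have /nbhs_ballE[r r0 rP] := fx _ e0.
apply/nbhs_ballE; exists r => // y yr.
have := rP (y - x); rewrite /= subr0 => /(_ yr).
by rewrite -[(_ - _) (y - x)]/(f (y - x + x) - (f x + 'd f x (y - x)))
  subrK opprD addrA.
Qed.

Lemma eps_differentiable {V W : normedModType R} (f : V -> W) x
  (df : {linear V -> W}) : continuous df ->
  (forall e, 0 < e ->
    \forall y \near x, `|f y - f x - df (y - x)| <= e * `|y - x|) ->
  differentiable f x /\ 'd f x = df :> (V -> W).
Proof.
move=> dfc fx.
have fo : f \o shift x = cst (f x) + df +o_ 0 id.
  apply/eqaddoP => e e0; have /nbhs_ballE[r r0 rP] := fx _ e0.
  apply/nbhs_ballE; exists r => // y; rewrite subr0 => yr.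
  have := rP (y + x); rewrite addrK => /(_ yr).
  by rewrite -[(_ - _) y]/(f (y + x) - (f x + df y)) opprD addrA.
have dE := diff_unique dfc fo.
by split=> //; apply/diff_locallyP; rewrite dE.
Qed.

End Differentials.

Section Taylor.
Context {R : realType} {n m : nat}.
Implicit Types (g : 'rV[R]_n -> 'rV[R]_m) (x y v : 'rV[R]_n).

Lemma dot_delta (k : nat) (u : 'rV[R]_k) j : dot (delta_mx 0 j) u = u 0 j.
Proof.
rewrite /dot (bigD1 j) //= mxE !eqxx mul1r big1 ?addr0 // => i /negPf ij.
by rewrite mxE ij andbF mul0r.
Qed.

(** The mean value theorem has no vector-valued form, so the increment is tested against a fixed
    [a]; the intermediate point depends on [a]. *)
Lemma dot_MVT g x y (a : 'rV[R]_m) :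
  (forall s : R, 0 <= s <= 1 -> differentiable g (x + s *: (y - x))) ->
  exists2 s : R, 0 <= s <= 1 &
    dot a (g y - g x) = dot a ('d g (x + s *: (y - x)) (y - x)).
Proof.
move=> dg; pose l (s : R) := x + s *: (y - x).
pose p (s : R) : R^o := dot a (g (l s)).
have dp (s : R) : 0 <= s <= 1 ->
    is_diff s p (fun h => dot a ('d g (l s) (h *: (y - x)))).
  move=> /dg dgs.
  have dl : is_diff s l (fun h => h *: (y - x)).
    have : is_diff s (cst x + *:%R^~ (y - x)) (0 + *:%R^~ (y - x)).
      exact: is_diffD.
    by rewrite add0r.
  have dgl := is_diff_comp dl (differentiableP dgs).
  have da : is_diff (g (l s)) (dot a : _ -> R^o) (dot a).
    apply: DiffDef; first exact/linear_differentiable/linear_rV_continuous.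
    exact/diff_lin/linear_rV_continuous.
  exact: is_diff_comp dgl da.
have [||s s01] := @MVT R p (fun s => dot a ('d g (l s) (y - x))) 0 1 ltr01.
- move=> s; rewrite in_itv /= => /andP[/ltW s0 /ltW s1].
  have dps := dp s _; rewrite s0 s1 in dps; have {}dps := dps isT.
  apply: DeriveDef; first exact/diff_derivable/ex_diff.
  by rewrite deriveE ?diff_val ?scale1r //; exact: ex_diff.
- apply: continuous_in_subspaceT => s; rewrite inE /= in_itv /= => s01.
  have dps := dp s s01.
  exact/differentiable_continuous/ex_diff.
- rewrite /p /l scale0r scale1r addr0 subrKC subr0 mulr1 => pE.
  exists s; last by rewrite dotBr.
  by move: s01; rewrite in_itv /= => /andP[/ltW-> /ltW->].
Qed.

End Taylor.

Lemma dot_self_continuous {R : realType} n (w : 'rV[R]_n) :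
  continuous (fun z : 'rV[R]_n => dot (z - w) (z - w) : R^o).
Proof.
refine (@continuous_big R^o 'I_n +%R 0 xpredT (@add_continuous R^o) 'rV[R]_n _
  (fun i (z : 'rV[R]_n) => (z - w) 0 i * (z - w) 0 i) _) => i _ z.
have zi : {for z, continuous (fun z : 'rV[R]_n => (z - w) 0 i : R^o)}.
  have zw : {for z, continuous (fun z : 'rV[R]_n => z - w)}.
    by apply: continuousB; [move=> ?|exact: cst_continuous].
  exact: (continuous_comp zw (@coord_continuous R 1 n 0 i _)).
exact: (continuousM zi zi).
Qed.

(** * Maps of class C^p: locality, Lipschitz and Taylor bounds *)

Section Smooth.
Context {R : realType} {n : nat}.

(** On an open set the differential at a point sees only nearby values, so the agreement of [f] and
    [g] passes to their derivatives by induction on [p]. *)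
Lemma Cp_ext (W : normedModType R) p (U : set 'rV[R]_n) (f g : 'rV[R]_n -> W) :
  open U -> (forall x, U x -> f x = g x) -> Cp p U f -> Cp p U g.
Proof.
elim: p f g => [|p IH] f g oU fg /=.
  move=> cf x Ux; rewrite /prop_for /continuous_at -fg //.
  have fgx : {near nbhs x, f =1 g}.
    by apply: filterS (open_nbhs_nbhs (conj oU Ux)) => y /fg.
  exact: cvg_trans (near_eq_cvg fgx) (cf x Ux).
move=> [df cf].
have dfg x : U x -> differentiable g x /\ forall v, 'd g x v = 'd f x v.
  move=> Ux; suff [? dE] : differentiable g x /\ 'd g x = 'd f x :> (_ -> _).
    by split=> [|v]; last exact: (congr1 (fun h => h v) dE).
  apply: eps_differentiable => [|e e0]; first exact/diff_continuous/df.
  apply: filterS2 (open_nbhs_nbhs (conj oU Ux)) (differentiable_eps (df x Ux) e0).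
  by move=> y Uy; rewrite !fg.
split=> [x Ux|v]; first by have [] := dfg x Ux.
refine (IH (fun x => 'd f x v) (fun x => 'd g x v) oU _ (cf v)) => x Ux.
by have [_ /(_ v) /esym] := dfg x Ux.
Qed.

Lemma Cp_sub (W : normedModType R) p (U V : set 'rV[R]_n) (f : 'rV[R]_n -> W) :
  V `<=` U -> Cp p U f -> Cp p V f.
Proof.
move=> VU; elim: p f => [|p IH] f /=; first by move=> cf x /VU/cf.
by move=> [df cf]; split=> [x /VU/df//|v]; apply: IH.
Qed.

Lemma CpW (W : normedModType R) p q (U : set 'rV[R]_n) (f : 'rV[R]_n -> W) :
  (p <= q)%N -> Cp q U f -> Cp p U f.
Proof.
elim: q p f => [|q IH] [|p] f //= pq [df cf].
  by move=> x /df/differentiable_continuous.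
by split=> // v; apply: IH.
Qed.

Lemma Cp_linear_comp (m : nat) (W : normedModType R) p (U : set 'rV[R]_n)
    (f : 'rV[R]_n -> 'rV[R]_m) (g : {linear 'rV[R]_m -> W}) (b : W) :
  open U -> Cp p U f -> Cp p U (fun x => b + g (f x)).
Proof.
move=> oU; elim: p f b => [|p IH] f b /=.
  move=> cf x /cf fx; apply: (@continuousD _ _ _ (cst b) (g \o f)).
    exact: cst_continuous.
  by apply: continuous_comp; [exact: fx|exact: linear_rV_continuous].
move=> [df cf].
have dgf x : U x -> is_diff x (fun x => b + g (f x)) (fun v => g ('d f x v)).
  move=> Ux; have dg : is_diff (f x) g g.
    apply: DiffDef; first exact/linear_differentiable/linear_rV_continuous.
    exact/diff_lin/linear_rV_continuous.
  have dfx := differentiableP (df x Ux).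
  have : is_diff x (cst b + (g \o f)) (0 + (g \o 'd f x)).
    exact: is_diffD (is_diff_comp dfx dg).
  by rewrite add0r.
split=> [x /dgf dx|v]; first exact: ex_diff.
refine (Cp_ext oU _ (IH (fun x => 'd f x v) 0 (cf v))) => x Ux.
by have dx := dgf x Ux; rewrite diff_val add0r.
Qed.

(** By continuity the partial derivatives stay bounded on a small ball. The mean value theorem is
    then applied to each coordinate separately, which costs no constant in the sup norm. *)
Lemma Cp1_lipschitz (m : nat) (U : set 'rV[R]_n) (f : 'rV[R]_n -> 'rV[R]_m) x0 :
  open U -> U x0 -> Cp 1 U f ->
  exists K r : R, [/\ 0 < K, 0 < r & forall x y, `|x - x0| < r ->
    `|y - x0| < r -> `|f x - f y| <= K * `|x - y|].
Proof.
move=> oU Ux0 [df cf].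
pose B (i : 'I_n) := `|'d f x0 (delta_mx 0 i)| + 1.
have nearB : \forall x \near x0, forall i, `|'d f x (delta_mx 0 i)| <= B i.
  refine (@near_forall R _ _
    (fun i x => `|'d f x (delta_mx 0 i)| <= B i) _ _) => i.
  have := cf (delta_mx 0 i) _ Ux0.
  move=> /cvgrPdist_lt/(_ _ ltr01); apply: filterS => x xi.
  rewrite -lerBlDl; apply: le_trans (lerB_dist _ _) _.
  by rewrite distrC ltW.
have /nbhs_ballE[r r0 rB] : \forall x \near x0,
    U x /\ forall i, `|'d f x (delta_mx 0 i)| <= B i.
  by apply: filterI nearB; exact: open_nbhs_nbhs.
have B0 : 0 <= \sum_i B i by apply: sumr_ge0 => i _; rewrite addr_ge0.
exists (1 + \sum_i B i), r; split=> //; first by rewrite ltr_pwDl.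
move=> x y xr yr.
apply: norm_le_coord => [|j].
  by rewrite mulr_ge0 // addr_ge0.
have [|s s01] := @dot_MVT R n m f y x (delta_mx 0 j).
  by move=> s /(segment_in_ball yr xr)/rB[/df].
rewrite !dot_delta => ->; apply: le_trans (coord_le_norm _ _) _.
apply: le_trans (linear_norm_le _ _) _; rewrite ler_wpM2r //.
rewrite -[leLHS]add0r lerD //; apply: ler_sum => i _.
by have [_] := rB _ (segment_in_ball yr xr s01); apply.
Qed.

(** Each partial derivative is C^1, hence Lipschitz near [x0], which makes the differential
    Lipschitz. The remainder compares the differentials at [x] and at an intermediate point;
    bounding [s] by 1 gives [K] in place of [K / 2]. *)
Lemma Cp2_taylor (m : nat) (U : set 'rV[R]_n) (f : 'rV[R]_n -> 'rV[R]_m) x0 :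
  open U -> U x0 -> Cp 2 U f ->
  exists K r : R, [/\ 0 < K, 0 < r, forall x, `|x - x0| < r -> U x,
    forall x y v, `|x - x0| < r -> `|y - x0| < r ->
      `|'d f x v - 'd f y v| <= K * `|x - y| * `|v| &
    forall x y, `|x - x0| < r -> `|y - x0| < r ->
      `|f y - f x - 'd f x (y - x)| <= K * `|y - x| ^+ 2].
Proof.
move=> oU Ux0 [df cf].
have Kr i : exists Kr : R * R, [/\ 0 < Kr.1, 0 < Kr.2 &
    forall x y, `|x - x0| < Kr.2 -> `|y - x0| < Kr.2 ->
    `|'d f x (delta_mx 0 i) - 'd f y (delta_mx 0 i)| <= Kr.1 * `|x - y|].
  have [K [r [K0 r0 Kr]]] := Cp1_lipschitz oU Ux0 (cf (delta_mx 0 i)).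
  by exists (K, r).
have {Kr}[Kr KrP] := choice Kr.
have /nbhs_ballE[r r0 rP] : \forall x \near x0,
    U x /\ forall i, `|x - x0| < (Kr i).2.
  apply: filterI; first exact: open_nbhs_nbhs.
  refine (@near_forall R _ _ (fun i x => `|x - x0| < (Kr i).2) _ _) => i.
  apply/nbhs_ballE.
  by exists (Kr i).2 => //; have [] := KrP i.
pose K := \sum_i (Kr i).1 + 1.
have K0 : 0 < K.
  rewrite ltr_pwDr // sumr_ge0 // => i _.
  by have [/ltW] := KrP i.
have lipK x y v : `|x - x0| < r -> `|y - x0| < r ->
    `|'d f x v - 'd f y v| <= K * `|x - y| * `|v|.
  move=> /rP[_ xr] /rP[_ yr].
  have := linear_norm_le ('d f x \- 'd f y) v.
  rewrite /= => /le_trans; apply; rewrite ler_wpM2r //.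
  apply: (@le_trans _ _ (\sum_i (Kr i).1 * `|x - y|)).
    by apply: ler_sum => i _; have [_ _] := KrP i; apply.
  by rewrite -mulr_suml ler_wpM2r // lerDl.
exists K, r; split=> // [x /rP[]//|x y xr yr].
apply: norm_le_coord => [|j].
  by rewrite mulr_ge0 ?exprn_ge0 // ltW.
have [|s s01] := @dot_MVT R n m f x y (delta_mx 0 j).
  by move=> s /(segment_in_ball xr yr)/rP[/df].
rewrite !dot_delta => fE.
have -> : (f y - f x - 'd f x (y - x)) 0 j =
    ('d f (x + s *: (y - x)) (y - x) - 'd f x (y - x)) 0 j.
  by rewrite mxE fE [RHS]mxE.
apply: le_trans (coord_le_norm _ _) _.
apply: le_trans (lipK _ _ _ (segment_in_ball xr yr s01) xr) _.
rewrite [x + _ - x]addrAC subrr add0r normrZ expr2.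
rewrite [leRHS]mulrA ler_wpM2r // ler_wpM2l ?(ltW K0) //.
case/andP: s01 => s0 s1; rewrite ger0_norm // ler_piMl //.
Qed.

End Smooth.

(** * Subspaces and sublinear functions *)

Section Subspaces.
Context {R : realType}.

(** Take [D] of maximal rank among matrices with row space inside [L]: adjoining a vector of [L]
    cannot raise the rank, so that vector already lies in the row space. *)
Lemma subspace_rowspace m (L : set 'rV[R]_m) :
  L 0 -> (forall a u v, L u -> L v -> L (a *: u + v)) ->
  exists D : 'M[R]_m, forall z, L z <-> (z <= D)%MS.
Proof.
move=> L0 LD.
pose Q r := `[< exists2 D : 'M[R]_m,
  forall z : 'rV_m, (z <= D)%MS -> L z & \rank D = r >].
have exQ : exists r, Q r.
  exists 0%N; apply/asboolP; exists 0; last exact: mxrank0.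
  by move=> z /submx0null->.
have ubQ r : Q r -> (r <= m)%N by move=> /asboolP[D _ <-]; exact: rank_leq_row.
have [r /asboolP[D DL <-] rmax] := ex_maxnP exQ ubQ.
exists D => z; split=> [Lz|]; last exact: DL.
have rDz : (\rank (D + z)%MS <= \rank D)%N.
  apply: rmax; apply/asboolP; exists (D + z)%MS => // u /sub_addsmxP[[a b] ->].
  rewrite addrC (mx11_scalar b) mul_scalar_mx.
  by apply: LD => //; apply: DL; exact: submxMl.
apply: submx_trans (addsmxSr D z) _.
by rewrite -(geq_leqif (mxrank_leqif_sup (addsmxSl D z))).
Qed.

(** The kernel of [cokermx D] is the row space of [D]. In its rank factorization the right factor is
    injective, so the left factor has the same kernel, and it has full column rank. *)
Lemma subspace_kernel m (D : 'M[R]_m) :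
  exists k (P : 'M[R]_(m, k)),
    row_full P /\ forall z : 'rV_m, (z <= D)%MS <-> z *m P = 0.
Proof.
exists (\rank (cokermx D)), (col_base (cokermx D)); split.
  exact: col_base_full.
move=> z; rewrite submxE -{1}(mulmx_base (cokermx D)) mulmxA.
split=> [/eqP zP|->]; last by rewrite mul0mx.
by apply/eqP; rewrite -(mulmx_free_eq0 _ (row_base_free (cokermx D))) zP.
Qed.

(** As [orth_proj] is a [get], existence suffices. The row space of [J^T] and the kernel of [J] are
    orthogonal, hence meet only in 0, and their dimensions add up to [n]; the kernel component of
    [v] is the projection. *)
Lemma orth_proj_kernel n k (J : 'M[R]_(n, k)) (T : set 'rV[R]_n) v :
  (forall w, T w <-> w *m J = 0) ->
  T (orth_proj T v) /\ forall w, T w -> dot (v - orth_proj T v) w = 0.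
Proof.
move=> TJ.
suff ex : exists u, T u /\ forall w, T w -> dot (v - u) w = 0.
  exact: (@getPex _ [set u | T u /\ forall w, T w -> dot (v - u) w = 0] ex).
have dotE (u w : 'rV[R]_n) : dot u w = (u *m w^T) 0 0.
  by rewrite mxE; apply: eq_bigr => i _; rewrite mxE.
have cap0 : (J^T :&: kermx J)%MS = 0.
  apply/eqP/rowV0P => u; rewrite sub_capmx => /andP[/submxP[a ua] /sub_kermxP uJ].
  have uu : dot u u = 0.
    by rewrite dotE {1}ua -mulmxA -trmx_mul uJ trmx0 mulmx0 mxE.
  apply/eqP; rewrite -normr_eq0 eq_le normr_ge0 andbT.
  by rewrite -(@ler_pXn2r _ 2) ?nnegrE // expr0n /=
    (le_trans (norm_sqr_le_dot u)) ?uu.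
have full : row_full (J^T + kermx J)%MS.
  rewrite /row_full -(addn0 (\rank _)) -(mxrank0 R n n) -cap0 mxrank_sum_cap.
  by rewrite mxrank_ker mxrank_tr subnKC ?rank_leq_row.
have /sub_addsmxP[[a b] /= vE] := submx_full v full.
exists (b *m kermx J); split; first by rewrite TJ -mulmxA mulmx_ker mulmx0.
move=> w /TJ wJ; rewrite dotE vE addrK -mulmxA -trmx_mul wJ.
by rewrite trmx0 mulmx0 mxE.
Qed.

End Subspaces.

Lemma convex_setE {R : realType} (V : lmodType R) (A : set V) :
  @convex_set R V A <->
  forall x y (s : R), 0 <= s <= 1 -> A x -> A y -> A (s *: x + (1 - s) *: y).
Proof.
split=> [cA x y s /andP[s0 s1] Ax Ay|cA x y s].
  by have := cA x y (Itv01 s0 s1); rewrite !inE; apply.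
rewrite !inE => Ax Ay; have := cA x y s%:num; apply=> //.
by rewrite ge0 le1.
Qed.

Section Sublinear.
Context {R : realType} {m : nat} (h : 'rV[R]_m -> R) (h_sub : sublinear h).

Lemma sublinearZ (t : R) z : 0 < t -> h (t *: z) = t * h z.
Proof.
case: h_sub => _ _ hK; have hZ s u : 0 < s -> h (s *: u) <= s * h u.
  move=> s0; exact: (hK s (u, h u) s0 (lexx (h u))).
move=> t0; apply/eqP; rewrite eq_le hZ //=.
have := hZ t^-1 (t *: z); rewrite invr_gt0 => /(_ t0).
by rewrite scalerA mulVf ?gt_eqF // scale1r ler_pdivlMl.
Qed.

Lemma sublinear0 : h 0 = 0.
Proof.
have := @sublinearZ 2 0 (ltr0Sn R 1); rewrite scaler0; lra.
Qed.

Lemma sublinearD z w : h (z + w) <= h z + h w.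
Proof.
case: h_sub => _ hC _.
have half01 : 0 <= (2^-1 : R) <= 1.
  by rewrite invr_ge0 ler0n invf_le1 ?ler1n ?ltr0n.
have /convex_setE hC' := hC.
have := hC' (z, h z) (w, h w) 2^-1 half01 (lexx (h z)) (lexx (h w)).
rewrite /epigraph /= (_ : 1 - 2^-1 = 2^-1); last by lra.
by rewrite -scalerDr -mulrDr sublinearZ ?invr_gt0 // ler_pM2l ?invr_gt0.
Qed.

Lemma sublinear_sum (I : Type) (r : seq I) (z : I -> 'rV[R]_m) :
  h (\sum_(i <- r) z i) <= \sum_(i <- r) h (z i).
Proof.
elim/big_ind2 : _ => // [|a b u v au bv]; first by rewrite sublinear0.
by apply: le_trans (sublinearD _ _) _; rewrite lerD.
Qed.

(** Expanding on the basis, with both signs of each basis vector, gives [h z <= C * |z|];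
    subadditivity [h z <= h (z - w) + h w] turns this growth bound into a Lipschitz bound. *)
Lemma sublinear_lipschitz :
  exists2 H : R, 0 < H & forall z w, h z - h w <= H * `|z - w|.
Proof.
pose B i := `|h (delta_mx 0 i)| + `|h (- delta_mx 0 i)|.
have hB z : h z <= (\sum_i B i) * `|z|.
  rewrite {1}(row_sum_delta z) mulr_suml.
  apply: le_trans (sublinear_sum _ _) _; apply: ler_sum => i _.
  apply: (@le_trans _ _ (B i * `|z 0 i|)); last first.
    by rewrite ler_wpM2l ?addr_ge0 ?coord_le_norm.
  have [zi|zi|->] := ltrgt0P (z 0 i).
  - rewrite sublinearZ // mulrC ler_wpM2r ?(ltW zi) //.
    by apply: le_trans (ler_norm _) _; rewrite lerDl.
  - rewrite -[z 0 i]opprK scaleNr -scalerN sublinearZ ?oppr_gt0 //.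
    rewrite opprK mulrC ler_wpM2r ?oppr_ge0 ?(ltW zi) //.
    by apply: le_trans (ler_norm _) _; rewrite lerDr.
  - by rewrite scale0r sublinear0 mulr0.
exists (1 + \sum_i B i) => [|z w].
  by rewrite ltr_pwDl // sumr_ge0 // => i _; rewrite addr_ge0.
rewrite lerBlDr -{1}(subrK w z); apply: le_trans (sublinearD _ _) _.
rewrite lerD2r; apply: le_trans (hB _) _.
by rewrite ler_wpM2r // lerDr.
Qed.

Lemma LinP z : Lin h z <-> h (- z) = - h z.
Proof.
rewrite /Lin /=; split=> [->|->]; last by rewrite opprK.
by rewrite opprK.
Qed.

Lemma sublinearN_ge z : 0 <= h z + h (- z).
Proof. by rewrite -sublinear0 -(subrr z) sublinearD. Qed.

(** Subadditivity gives one inequality; applied to [z + l] and [- l], with [h (- l) = - h l], it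
    gives the other. *)
Lemma sublinear_LinD z l : Lin h l -> h (z + l) = h z + h l.
Proof.
move=> /LinP hl; apply/eqP; rewrite eq_le sublinearD /=.
have := sublinearD (z + l) (- l); rewrite addrK hl.
by rewrite lerBrDr.
Qed.

Lemma LinZ a l : Lin h l -> Lin h (a *: l) /\ h (a *: l) = a * h l.
Proof.
move=> Ll; have /LinP hl := Ll.
have [a0|a0|->] := ltrgt0P a.
- rewrite sublinearZ //; split=> //; apply/LinP.
  by rewrite -scalerN !sublinearZ // hl mulrN.
- have an0 : 0 < - a by rewrite oppr_gt0.
  have hal : h (a *: l) = a * h l.
    by rewrite -(opprK a) scaleNr -scalerN sublinearZ // hl mulrNN opprK.
  split=> //; apply/LinP.
  by rewrite hal -scaleNr sublinearZ // mulNr.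
- rewrite scale0r mul0r sublinear0; split=> //.
  by apply/LinP; rewrite oppr0 sublinear0 oppr0.
Qed.

Lemma LinD u v : Lin h u -> Lin h v -> Lin h (u + v).
Proof.
move=> Lu Lv; apply/LinP; have LNv : Lin h (- v).
  by rewrite -scaleN1r; case: (LinZ (-1) Lv).
rewrite opprD (sublinear_LinD (- u) LNv) (sublinear_LinD u Lv).
by move/LinP: Lu => ->; move/LinP: Lv => ->; rewrite opprD.
Qed.

Lemma sublinear_Lin_sum (I : Type) (r : seq I) (a : I -> R) (z : I -> 'rV[R]_m) :
  (forall i, Lin h (z i)) ->
  h (\sum_(i <- r) a i *: z i) = \sum_(i <- r) a i * h (z i).
Proof.
move=> Lz; elim: r => [|i r IH]; first by rewrite !big_nil sublinear0.
rewrite !big_cons addrC sublinear_LinD; last by case: (LinZ (a i) (Lz i)).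
by case: (LinZ (a i) (Lz i)) => _ ->; rewrite IH addrC.
Qed.

(* [P] presents the quotient by [Lin h], and [l] extends [h] from [Lin h]. *)
Lemma Lin_kernel : exists k (P : 'M[R]_(m, k)) (l : 'rV[R]_m),
  [/\ row_full P, forall z, Lin h z <-> z *m P = 0 &
      forall z, Lin h z -> h z = dot l z].
Proof.
have L0 : Lin h 0 by apply/LinP; rewrite oppr0 sublinear0 oppr0.
have LZD a u v : Lin h u -> Lin h v -> Lin h (a *: u + v).
  by move=> /(LinZ a)[Lau _]; exact: LinD.
have [D LD] := subspace_rowspace L0 LZD.
have [k [P [fullP DP]]] := subspace_kernel D.
(* A row [z] of the row space equals [(z *m pinvmx D) *m D], so linearity of [h] on [Lin h]
   expresses [h z] through the values at the rows of [D]. *)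
exists k, P, (\row_j \sum_i (pinvmx D) j i * h (row i D)).
split=> // [z|z /LD zD]; first by rewrite LD.
have LDi i : Lin h (row i D) by apply/LD; exact: row_sub.
rewrite -{1}(mulmxKpV zD) mulmx_sum_row sublinear_Lin_sum //.
under eq_bigr do rewrite mxE mulr_suml.
rewrite exchange_big /=; apply: eq_bigr => j _; rewrite mxE mulr_suml.
by apply: eq_bigr => i _; ring.
Qed.

End Sublinear.

(** * Tangent vectors of level sets *)

Section Lyusternik.
Context {R : realType}.

HB.instance Definition _ k := Complete.on 'rV[R]_k.

Lemma linear_right_inverse n k (g : {linear 'rV[R]_n -> 'rV[R]_k}) :
  range g = [set: 'rV[R]_k] ->
  exists B : 'M[R]_(k, n), forall z, g (z *m B) = z.
Proof.
move=> gT.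
have gb i : exists b, g b = delta_mx 0 i.
  by have [b _ bE] : range g (delta_mx 0 i); [rewrite gT|exists b].
have [b bE] := choice gb.
exists (\matrix_i b i) => z; rewrite mulmx_sum_row linear_sum [RHS]row_sum_delta.
by apply: eq_bigr => i _; rewrite linearZ /= rowK bE.
Qed.

Lemma closed_norm_ball k (x : 'rV[R]_k) (rho : R) :
  closed [set z : 'rV[R]_k | `|z - x| <= rho].
Proof.
rewrite (_ : mkset _ = closed_ball_ Num.norm x rho).
  exact: closed_closed_ball_.
by apply/seteqP; split=> z; rewrite /closed_ball_ /= distrC.
Qed.

(** The ball of radius [rho] is stable because [|Phi z| <= |Phi z - Phi 0| + |Phi 0| <= rho / 2 +
    rho / 2]; Banach's theorem applies there. *)
Lemma contraction_fixpoint k (rho : R) (Phi : 'rV[R]_k -> 'rV[R]_k) :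
  0 <= rho -> `|Phi 0| <= rho / 2 ->
  (forall z w, `|z| <= rho -> `|w| <= rho ->
    `|Phi z - Phi w| <= 2^-1 * `|z - w|) ->
  exists2 z, `|z| <= rho & Phi z = z.
Proof.
move=> rho0 Phi0 PhiL; pose Z := [set z : 'rV[R]_k | `|z - 0| <= rho].
have PhiZ : set_fun Z Z Phi.
  move=> z; rewrite /Z /= !subr0 => zrho; rewrite -(subrK (Phi 0) (Phi z)).
  apply: le_trans (ler_normD _ _) _.
  have := PhiL z 0 zrho; rewrite normr0 subr0 => /(_ rho0).
  by lra.
pose PhiM := isFun.Build _ _ Z Z Phi PhiZ.
pose f : {fun Z >-> Z} := HB.pack Phi PhiM.
have half0 : 0 <= (2^-1 : R) by rewrite invr_ge0.
have ctr : is_contraction f.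
  exists (NngNum half0); split; first by rewrite /= invf_lt1 ?ltr1n.
  by move=> [z w] [/=]; rewrite /Z /= !subr0; exact: PhiL.
have [|z zr zE] := banach_fixed_point ctr (@closed_norm_ball k 0 rho).
  by exists 0; rewrite /Z /= subr0 normr0.
by exists z => //; move: zr; rewrite /Z /= subr0.
Qed.

(* Lyusternik's theorem: correct [y + t *: v] along a right inverse of ['d F y],
   by a Newton iteration with frozen derivative. *)
Lemma tangent_curve n k (U : set 'rV[R]_n) (F : 'rV[R]_n -> 'rV[R]_k) y v :
  open U -> U y -> Cp 2 U F -> F y = 0 ->
  range ('d F y) = [set: 'rV[R]_k] -> 'd F y v = 0 ->
  exists C delta : R, [/\ 0 <= C, 0 < delta & forall t, 0 < t < delta ->
    exists2 x, F x = 0 & `|x - (y + t *: v)| <= C * t ^+ 2].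
Proof.
move=> oU Uy CF Fy dFT dFv.
have [B BE] := linear_right_inverse dFT.
have [b b0 bB] := mulmx_norm_le B.
have [K [r [K0 r0 _ dFL FT]]] := Cp2_taylor oU Uy CF.
(* For [t <= 1] all points of the iteration stay within [t * A] of [y], and [t * D < 1] makes the
   iteration a contraction of ratio 1/2. *)
pose A := `|v| * (1 + 2 * b * K * `|v|).
have A0 : 0 <= A by rewrite /A mulr_ge0 // addr_ge0 // !mulr_ge0 // ltW.
pose D := 6 * K * b * A.
have D0 : 0 <= D by apply: mulr_ge0 A0; rewrite !mulr_ge0 // ltW.
exists (b * (2 * K * `|v| ^+ 2)),
  (Num.min 1 (Num.min (r / (A + 1)) (D + 1)^-1)).
split; first by rewrite !mulr_ge0 ?exprn_ge0 // ltW.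
  by rewrite !lt_min ltr01 /= divr_gt0 ?invr_gt0 // ltr_wpDl.
move=> t; rewrite !lt_min => /and4P[t0 t1 tr tD].
(* Twice the Taylor bound [K * |t *: v| ^+ 2] for [F (y + t *: v)], as the contraction lemma asks at
   0. *)
pose rho := 2 * K * `|v| ^+ 2 * t ^+ 2.
have rho0 : 0 <= rho by rewrite /rho !mulr_ge0 ?exprn_ge0 // ltW.
pose X z := y + t *: v + z *m B.
pose sigma := t * `|v| + b * rho.
have sigmaA : sigma <= t * A.
  rewrite /sigma /rho /A.
  have : 0 <= (1 - t) * (t * (2 * b * K * `|v| ^+ 2)).
    by rewrite !mulr_ge0 ?exprn_ge0 ?subr_ge0 // ltW.
  by lra.
have sigma_r : sigma < r.
  move: tr; rewrite ltr_pdivlMr ?ltr_wpDl // mulrDr mulr1.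
  by lra.
have sigmaK : K * (3 * sigma) * b <= 2^-1.
  have tD1 : t * (D + 1) < 1 by move: tD; rewrite -[_^-1]mul1r ltr_pdivlMr ?ltr_wpDl.
  have : sigma * (6 * K * b) <= t * A * (6 * K * b).
    by rewrite ler_wpM2r // !mulr_ge0 // ltW.
  by move: tD1; rewrite /D; lra.
have Xy z : `|z| <= rho -> `|X z - y| <= sigma.
  move=> zrho; rewrite /X addrAC (addrAC y) subrr add0r.
  apply: le_trans (ler_normD _ _) _; rewrite normrZ gtr0_norm // lerD2l.
  by apply: le_trans (bB z) _; rewrite ler_wpM2l // ltW.
have XB z w : X z - X w = (z - w) *m B.
  by rewrite /X mulmxBl opprD addrACA subrr add0r.
have Xr z : `|z| <= rho -> `|X z - y| < r by move=> /Xy/le_lt_trans; exact.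
have y_r : `|y - y| < r by rewrite subrr normr0.
have [| |z zrho zE] := @contraction_fixpoint k rho (fun z => z - F (X z)) rho0.
- rewrite sub0r normrN.
  have X0 : X 0 - y = t *: v by rewrite /X mul0mx addr0 addrAC subrr add0r.
  have Xr0 := Xr 0; rewrite normr0 in Xr0.
  have := FT y (X 0) y_r (Xr0 rho0); rewrite X0 Fy subr0.
  rewrite linearZ /= dFv scaler0 subr0.
  rewrite normrZ gtr0_norm // /rho.
  by rewrite exprMn; lra.
- move=> z w zr wr.
  have [u uE] : exists u, u = X z - X w by exists (X z - X w).
  (* Since ['d F y u = z - w], the difference splits into a variation of the differential, at most
     [K * sigma * |u|], and a Taylor remainder, at most [K * (2 * sigma) * |u|]. *)
  have -> : z - F (X z) - (w - F (X w)) =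
      - ('d F (X w) u - 'd F y u) - (F (X z) - F (X w) - 'd F (X w) u).
    have eqE (a p q : 'rV[R]_k) :
        z - p - (w - q) = - (a - (z - w)) - (p - q - a).
      by apply/rowP => i; rewrite !mxE; ring.
    have dFu : z - w = 'd F y u by rewrite uE XB; apply/esym/BE.
    by rewrite (eqE ('d F (X w) u)) dFu.
  have uzw : `|u| <= b * `|z - w| by rewrite uE XB.
  have u_sigma : `|u| <= 2 * sigma.
    have -> : u = (X z - y) - (X w - y) by rewrite uE opprB addrA subrK.
    apply: le_trans (ler_normB _ _) _.
    by have := Xy z zr; have := Xy w wr; lra.
  have dFLu := dFL (X w) y u (Xr w wr) y_r.
  have := FT (X w) (X z) (Xr w wr) (Xr z zr); rewrite -uE => FTu.
  apply: le_trans (ler_normB _ _) _; rewrite normrN.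
  apply: le_trans (lerD dFLu FTu) _.
  apply: (@le_trans _ _ (K * (3 * sigma) * `|u|)).
    have -> : K * (3 * sigma) * `|u| = K * sigma * `|u| + K * (2 * sigma) * `|u|.
      by ring.
    apply: lerD; first by rewrite ler_wpM2r // ler_wpM2l ?Xy // ltW.
    by rewrite expr2 mulrA ler_wpM2r // ler_wpM2l // ltW.
  have K3 : 0 <= K * (3 * sigma).
    by rewrite !mulr_ge0 ?addr_ge0 ?mulr_ge0 // ltW.
  apply: (@le_trans _ _ (K * (3 * sigma) * (b * `|z - w|))).
    by rewrite ler_wpM2l.
  by rewrite mulrA ler_wpM2r.
- exists (X z).
    by move: zE => /eqP; rewrite -subr_eq0 addrAC subrr add0r oppr_eq0 => /eqP.
  rewrite /X addrAC subrr add0r; apply: le_trans (bB z) _.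
  by rewrite -mulrA ler_wpM2l // ltW.
Qed.

(** Along the curve [y + t *: v + O(t^2)] inside the level set [psi] vanishes, so [t *: 'd psi y v]
    is [o(t)]. This makes tangent spaces independent of the defining map and covariant gradients
    independent of the extension. *)
Lemma tangent_diff0 n k (W : normedModType R) (U : set 'rV[R]_n)
    (F : 'rV[R]_n -> 'rV[R]_k) (psi : 'rV[R]_n -> W) y v :
  open U -> U y -> Cp 2 U F -> F y = 0 ->
  range ('d F y) = [set: 'rV[R]_k] -> 'd F y v = 0 ->
  differentiable psi y -> (\forall x \near y, F x = 0 -> psi x = 0) ->
  'd psi y v = 0.
Proof.
move=> oU Uy CF Fy dFT dFv dpsi psi0.
have [C [delta [C0 delta0 curve]]] := tangent_curve oU Uy CF Fy dFT dFv.
apply/eqP; rewrite -normr_eq0; apply/negPn/negP => dv0.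
have {}dv0 : 0 < `|'d psi y v| by rewrite lt_def dv0 /=.
pose kap := \sum_i `|'d psi y (delta_mx 0 i)|.
have kap0 : 0 <= kap by exact: sumr_ge0.
(* With this [e] the final estimate reads [t * |'d psi y v| <= t * |'d psi y v| / 2], a
   contradiction. *)
pose e := `|'d psi y v| / (2 * (`|v| + 1)).
have e0 : 0 < e by rewrite divr_gt0 // mulr_gt0 // ltr_wpDl.
have psiy : psi y = 0 by exact: (nbhs_singleton psi0).
have /nbhs_ballE[r r0 rP] : \forall x \near y, (F x = 0 -> psi x = 0) /\
    `|psi x - psi y - 'd psi y (x - y)| <= e * `|x - y|.
  exact: (filterI psi0 (differentiable_eps dpsi e0)).
pose G := (e + kap) * C + 1; have G0 : 0 < G.
  by rewrite ltr_wpDl // mulr_ge0 // addr_ge0 // ltW.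
pose S := `|v| + C + 1; have S0 : 0 < S by rewrite ltr_wpDl // addr_ge0.
(* The four bounds put [t] in the range of the curve, absorb the [t ^+ 2] terms into [e * t], give
   [t ^+ 2 <= t], and keep [x] within [r] of [y]. *)
pose t := Num.min (delta / 2) (Num.min (e / G / 2) (Num.min 1 (r / S / 2))).
have t0 : 0 < t by rewrite !lt_min ltr01 !divr_gt0.
have tdelta : t < delta.
  by apply: (@le_lt_trans _ _ (delta / 2)); [rewrite ge_min lexx|lra].
have tG : t * G < e.
  rewrite -ltr_pdivlMr //; apply: (@le_lt_trans _ _ (e / G / 2)).
    by rewrite !ge_min lexx !orbT.
  by rewrite ltr_pdivrMr // ltr_pMr ?ltr1n // divr_gt0.
have t1 : t <= 1 by rewrite !ge_min lexx !orbT.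
have tS : t * S < r.
  rewrite -ltr_pdivlMr //; apply: (@le_lt_trans _ _ (r / S / 2)).
    by rewrite !ge_min lexx !orbT.
  by rewrite ltr_pdivrMr // ltr_pMr ?ltr1n // divr_gt0.
have [|x Fx xt] := curve t; first by rewrite t0.
pose w := x - (y + t *: v).
have xyE : x - y = t *: v + w by rewrite /w; apply/rowP => i; rewrite !mxE; ring.
have xy : `|x - y| <= t * `|v| + C * t ^+ 2.
  rewrite xyE; apply: le_trans (ler_normD _ _) _.
  by rewrite normrZ gtr0_norm // lerD2l.
have tt : C * t ^+ 2 <= C * t by rewrite ler_wpM2l // expr2 ler_piMl // ltW.
have [|/(_ Fx) psix dx] := rP x.
  by apply: le_lt_trans xy _; move: tS; rewrite /S; lra.
move: dx; rewrite psix psiy subr0 sub0r normrN => dx.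
have dw : `|'d psi y w| <= kap * (C * t ^+ 2).
  by apply: le_trans (linear_norm_le _ _) _; rewrite ler_wpM2l.
have dtv : t * `|'d psi y v| <= `|'d psi y (x - y)| + `|'d psi y w|.
  apply: le_trans (ler_normB _ _).
  by rewrite -linearB xyE addrK linearZ /= normrZ gtr0_norm.
have ev : e * (`|v| + 1) * 2 = `|'d psi y v|.
  by rewrite /e -mulrA [_ * 2]mulrC divfK // gt_eqF // mulr_gt0 // ltr_wpDl.
have : t * `|'d psi y v| <= t * (e * (`|v| + 1)).
  have : e * `|x - y| <= e * (t * `|v| + C * t ^+ 2) by rewrite ler_wpM2l // ltW.
  have : t * (t * G) <= t * e by rewrite ler_wpM2l ?(ltW t0) // ltW.
  have : 0 <= t ^+ 2 by rewrite exprn_ge0 // ltW.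
  by rewrite /G; lra.
rewrite ler_pM2l // -ev; nra.
Qed.

End Lyusternik.

(** A preimage of [y] is a fixed point of [z |-> y + z - g z], a contraction of ratio 1/2 whose
    value at 0 is [y]; hence the radius [2 * |y|]. *)
Lemma near_identity_surjective {R : realType} k
    (g : {linear 'rV[R]_k -> 'rV[R]_k}) :
  (forall z, `|g z - z| <= 2^-1 * `|z|) -> forall y, exists z, g z = y.
Proof.
move=> gid y; have y0 : 0 <= 2 * `|y| by rewrite mulr_ge0.
have [| |z _ zE] := @contraction_fixpoint R k _ (fun z => y + z - g z) y0.
- by rewrite linear0 subr0 addr0 mulrAC mulfV ?mul1r // pnatr_eq0.
- move=> z w _ _.
  have -> : y + z - g z - (y + w - g w) = - (g (z - w) - (z - w)).
    rewrite (linearB g); move: (g z) (g w) => a b.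
    by apply/rowP => i; rewrite !mxE; ring.
  by rewrite normrN.
- exists z; apply/esym/(addrI z); apply/eqP.
  by rewrite addrC -subr_eq zE.
Qed.

(** The minimum over the compact unit sphere is positive, and homogeneity spreads it to all
    vectors. *)
Lemma homogeneous_lower_bound {R : realType} k (g : 'rV[R]_k -> R) :
  continuous (g : _ -> R^o) -> (forall t z, 0 < t -> g (t *: z) = t * g z) ->
  g 0 = 0 -> (forall z, z != 0 -> 0 < g z) ->
  exists2 e : R, 0 < e & forall z, e * `|z| <= g z.
Proof.
move=> gc gZ g0 gpos; pose S := [set z : 'rV[R]_k | `|z| = 1].
have unitS z : z != 0 -> S (`|z|^-1 *: z).
  move=> z0; rewrite /S /= normrZ normfV normr_id mulVf //.
  by rewrite normr_eq0.
(* If the sphere is empty, as in dimension 0, every [z] is 0 and any constant serves. *)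
have [S0|/set0P/negP/negPn/eqP S0] := pselect (S !=set0); last first.
  exists 1 => // z; have [->|/unitS] := eqVneq z 0; last by rewrite S0.
  by rewrite normr0 mulr0 g0.
have cS : compact S.
  apply: bounded_closed_compact.
    by exists 1; split=> [|M M1 z /= zS]; rewrite ?num_real // zS ltW.
  apply: (@closed_comp _ _ (Num.norm : 'rV[R]_k -> R) [set x | x = 1]).
    by move=> z _; exact: norm_continuous.
  exact: closed_eq.
have [|z0 /set_mem z0S z0min] := @EVT_min_rV R k g S S0 cS.
  exact: continuous_subspaceT.
have z0_neq0 : z0 != 0 by rewrite -normr_eq0 z0S oner_neq0.
exists (g z0); first exact: gpos.
move=> z; have [->|z_neq0] := eqVneq z 0; first by rewrite normr0 mulr0 g0.
have nz : 0 < `|z| by rewrite normr_gt0.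
have := z0min _ (mem_set (unitS z z_neq0)).
by rewrite gZ ?invr_gt0 // ler_pdivlMl // mulrC.
Qed.

Lemma locally_lipschitz_bound {R : realType} {V : normedModType R} {n : nat}
    (f : 'rV[R]_n -> V) x0 : locally_lipschitz f ->
  exists L r : R, [/\ 0 <= L, 0 < r & forall x y, `|x - x0| < r ->
    `|y - x0| < r -> `|f x - f y| <= L * `|x - y|].
Proof.
move=> /(_ x0)[U Ux0 /pinfty_ex_gt0[L L0 fL]].
have /nbhs_ballE[r r0 rU] : \forall y \near x0, U y by [].
exists L, r; split=> // [|x y /rU Ux /rU Uy]; first exact: ltW.
exact: (fL (x, y) (conj Ux Uy)).
Qed.

(** * Composite functions *)

Lemma near0_small {R : realType} (a b : R) :
  0 < b -> \forall t \near 0^'+, t * a < b.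
Proof.
move=> b0; have a0 : 0 < `|a| + 1 by rewrite ltr_wpDl.
near=> t.
apply: (@le_lt_trans _ _ (t * (`|a| + 1))).
  by rewrite ler_wpM2l // (le_trans (ler_norm a)) // lerDl.
rewrite -ltr_pdivlMr //; near: t; apply: nbhs_right_lt; exact: divr_gt0.
Unshelve. all: by end_near. Qed.

Lemma cvg_natSinv {R : realType} {V : normedModType R} (s : nat -> V) l :
  (forall j, `|s j - l| < j.+1%:R^-1) -> s @ \oo --> l.
Proof.
move=> sl; apply/cvgrPdist_lt => e e0.
near=> j; rewrite distrC; apply: lt_trans (sl j) _.
near: j; exact: (near_infty_natSinv_lt (PosNum e0)).
Unshelve. all: by end_near. Qed.

(** The bounded gradients have a cluster point by compactness, and the lower bound on [dot _ w]
    passes to the limit. *)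
Lemma limiting_gradients_compact {R : realType} {n : nat}
    (f : 'rV[R]_n -> R^o) (x w : 'rV[R]_n) (N eta : R) :
  (forall e, 0 < e -> exists u, [/\ `|u - x| < e, differentiable f u,
     `|gradient f u| <= N & eta <= dot (gradient f u) w]) ->
  exists2 q, limiting_gradients f x q & eta <= dot q w.
Proof.
move=> ex; have jinv0 (j : nat) : 0 < j.+1%:R^-1 :> R by rewrite invr_gt0.
have [u uP] := choice (fun j : nat => ex _ (jinv0 j)).
pose Q := [set p : 'rV[R]_n | `|p - 0| <= N].
have cQ : compact Q.
  apply: bounded_closed_compact; last exact: closed_norm_ball.
  exists N; split=> [|M NM p]; first exact: num_real.
  by rewrite /Q /= subr0 => /le_trans; apply; exact: ltW.
pose g j := gradient f (u j).
have gQ : (g @ \oo) Q.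
  by exists 0%N => // j _; rewrite /Q /= subr0; have [] := uP j.
have [q [_ qcl]] := cQ _ _ gQ.
(* Indices [k j >= j] need not increase: [j <= k j] alone makes [u (k j)] converge to [x]. *)
have sub j : exists k, (j <= k)%N /\ `|g k - q| < j.+1%:R^-1.
  have near_q : \forall p \near q, `|p - q| < j.+1%:R^-1.
    by apply/nbhs_ballE; exists j.+1%:R^-1.
  have tail : (g @ \oo) [set p | exists2 k, (j <= k)%N & p = g k].
    by exists j => // k jk; exists k.
  by have [_ [[k jk ->] kq]] := qcl _ _ tail near_q; exists k.
have [k kP] := choice sub.
have gq : g \o k @ \oo --> q by apply: cvg_natSinv => j; have [] := kP j.
exists q.
  exists (u \o k); split=> [|i|]; [|by have [] := uP (k i)|exact: gq].
  apply: cvg_natSinv => j /=; have [jk _] := kP j.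
  have [ukx _ _ _] := uP (k j); apply: lt_le_trans ukx _.
  by rewrite lef_pV2 ?posrE // ler_nat.
have gw : (fun j => dot w (g (k j)) : R^o) @ \oo --> (dot w q : R^o).
  by apply: continuous_cvg gq; exact: linear_rV_continuous.
rewrite dotC; apply: ler_cvg_to (cvg_cst eta) gw _.
by apply: nearW => j; rewrite dotC; have [] := uP (k j).
Qed.

(** * Subgradients of the composite function near [x0] *)

Section Composite.
Context {R : realType} {d m : nat}.
Variables (f : 'rV[R]_d -> R) (x0 : 'rV[R]_d).
Variables (c : 'rV[R]_d -> 'rV[R]_m) (h : 'rV[R]_m -> R) (H K r : R).
Hypotheses (h_sub : sublinear h) (H0 : 0 < H)
  (hL : forall z w, h z - h w <= H * `|z - w|)
  (cC2 : Cp 2 setT c) (cx0 : c x0 = 0) (K0 : 0 < K) (r0 : 0 < r)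
  (dcL : forall x y v, `|x - x0| < r -> `|y - x0| < r ->
      `|'d c x v - 'd c y v| <= K * `|x - y| * `|v|)
  (cT : forall x y, `|x - x0| < r -> `|y - x0| < r ->
      `|c y - c x - 'd c x (y - x)| <= K * `|y - x| ^+ 2)
  (fE : forall y, `|y - x0| < r -> f y = f x0 + h (c y)).

Lemma sublinear_continuous : continuous (h : _ -> R^o).
Proof.
move=> z; apply: continuous_eps => e e0.
exists (e / H); first exact: divr_gt0.
move=> y; rewrite ltr_pdivlMr // => yz.
apply: le_lt_trans yz; rewrite mulrC.
have := hL y z; have := hL z y; rewrite (distrC z y) => hzy hyz.
by rewrite ler_norml; apply/andP; split; lra.
Qed.

(* Unlike the multiplier form [q \in 'd c x^T (subdifferential of h at c x)],
   this inequality is visibly closed in [(x, q)] and convex in [q]. *)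
Definition model_subgradient x q :=
  forall v, dot q v <= h (c x + 'd c x v) - h (c x).

Lemma model_le x v : `|x - x0| < r -> `|x + v - x0| < r ->
  h (c x + 'd c x v) <= h (c (x + v)) + H * K * `|v| ^+ 2.
Proof.
move=> xr xvr; rewrite -lerBlDl; apply: le_trans (hL _ _) _.
have := cT xr xvr; rewrite [x + v - x]addrAC subrr add0r => cxv.
rewrite -mulrA ler_wpM2l ?(ltW H0) // -normrN opprB opprD addrA.
by [].
Qed.

(** A Fréchet supergradient: it covers both gradients and the slopes of smooth functions touching
    [f] from above. *)
Definition upper_gradient u p := forall e, 0 < e ->
  \forall y \near u, f y - f u <= dot p (y - u) + e * `|y - u|.

(** The upper bound is used at [u - t *: v]; convexity of [h] reflects it to the direction [v], and
    the Taylor error of order [t ^+ 2] disappears after division by [t]. *)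
Lemma upper_model_subgradient u p :
  `|u - x0| < r -> upper_gradient u p -> model_subgradient u p.
Proof.
move=> ur up v; apply/ler_addgt0Pr => e0 e0_gt0.
pose e := e0 / (2 * (`|v| + 1)).
have v1 : 0 < `|v| + 1 by rewrite ltr_wpDl.
have e_gt0 : 0 < e by rewrite divr_gt0 // mulr_gt0.
have eE : e * (`|v| + 1) * 2 = e0.
  by rewrite /e -mulrA [_ * 2]mulrC divfK // gt_eqF // mulr_gt0.
have /nbhs_ballE[s s0 sP] := up e e_gt0.
have rad : 0 < Num.min s (r - `|u - x0|) by rewrite lt_min s0 subr_gt0.
have [t [[t0 tv] tK]] : exists t,
    (0 < t /\ t * `|v| < Num.min s (r - `|u - x0|)) /\
    t * (H * K * `|v| ^+ 2) < e.
  apply: (@filter_ex _ (0 : R)^'+); apply: filterI; last exact: near0_small.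
  by apply: filterI; [exact: nbhs_right_gt|exact: near0_small].
move: tv; rewrite lt_min => /andP[tvs tvr].
have normtv : `|- (t *: v)| = t * `|v| by rewrite normrN normrZ gtr0_norm.
have yr : `|u - t *: v - x0| < r.
  rewrite addrAC; apply: le_lt_trans (ler_normD _ _) _; rewrite normtv; lra.
have yu : u - t *: v - u = - (t *: v) by rewrite addrAC subrr add0r.
have := sP (u - t *: v); rewrite yu normtv => /(_ tvs).
rewrite (fE yr) (fE ur) dotNr dotZr => fup.
have := model_le ur yr; rewrite normtv linearN linearZ /= => hup.
(* [(1 + t) c = t (c + dc v) + (c - t dc v)]: convexity turns the upper bound
   in the direction [- v] into a lower bound in the direction [v]. *)
have : h ((1 + t) *: c u) <= t * h (c u + 'd c u v) + h (c u - t *: 'd c u v).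
  rewrite -sublinearZ //; apply: le_trans (sublinearD h_sub _ _).
  rewrite (_ : t *: _ + _ = (1 + t) *: c u) //.
  by rewrite scalerDr addrACA subrr addr0 scalerDl scale1r addrC.
rewrite sublinearZ ?addr_gt0 // => hcvx.
have tK' : t * (t * (H * K * `|v| ^+ 2)) <= t * e.
  by rewrite ler_wpM2l // ltW.
rewrite -(ler_pM2l t0); have : 0 <= t * e by rewrite mulr_ge0 // ltW.
have : t * e * (`|v| + 1) * 2 = t * e0 by rewrite -eE; ring.
have : 0 <= t * e * `|v| by rewrite !mulr_ge0 // ltW.
by lra.
Qed.

(** The supergradient bounds [f] from above and the convex model, up to a quadratic error, from
    below; both bounds have slope [p]. *)
Lemma model_subgradient_diff u p : `|u - x0| < r ->
  upper_gradient u p -> model_subgradient u p ->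
  differentiable (f : _ -> R^o) u /\ gradient f u = p.
Proof.
move=> ur up mp.
have dotc : continuous (dot p : _ -> R^o) by exact: linear_rV_continuous.
suff [df dfE] : differentiable (f : _ -> R^o) u /\
    'd (f : _ -> R^o) u = dot p :> (_ -> R^o).
  split=> //; apply: dot_inj => v; rewrite dot_gradient.
  exact: (congr1 (fun g => g v) dfE).
apply: (eps_differentiable dotc) => e e0.
have rad : 0 < Num.min (r - `|u - x0|) (e / (H * K)).
  by rewrite lt_min subr_gt0 ur divr_gt0 ?mulr_gt0.
have nearu : \forall y \near u, `|y - u| < Num.min (r - `|u - x0|) (e / (H * K)).
  by apply/nbhs_ballE; eexists; first exact: rad.
apply: filterS2 nearu (up e e0) => y; rewrite lt_min => /andP[yr yK] fup.
have y_r : `|y - x0| < r.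
  have -> : y - x0 = (y - u) + (u - x0) by rewrite addrA subrK.
  by apply: le_lt_trans (ler_normD _ _) _; lra.
have yE : u + (y - u) = y by rewrite subrKC.
have := @model_le u (y - u) ur; rewrite yE => /(_ y_r) hup.
have := mp (y - u) => mpy.
have : `|y - u| * (`|y - u| * (H * K)) <= `|y - u| * e.
  rewrite ler_wpM2l // ltW //.
  by move: yK; rewrite ltr_pdivlMr // mulr_gt0.
move: fup; rewrite (fE y_r) (fE ur) => fup yy.
by rewrite ler_norml; apply/andP; split; lra.
Qed.

Lemma model_subgradient_closed x q (u g : nat -> 'rV[R]_d) :
  u @ \oo --> x -> g @ \oo --> q ->
  (\forall i \near \oo, model_subgradient (u i) (g i)) ->
  model_subgradient x q.
Proof.
move=> ux gq mg v.
have [dc cdc] := cC2.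
have cu : c \o u @ \oo --> c x.
  by apply: continuous_cvg ux; apply: differentiable_continuous; exact: dc.
have dcu : (fun i => 'd c (u i) v) @ \oo --> 'd c x v.
  exact: (cvg_comp _ (fun x => 'd c x v) ux
    (differentiable_continuous ((cdc v).1 x I))).
have gv : (fun i => dot v (g i) : R^o) @ \oo --> (dot v q : R^o).
  by apply: continuous_cvg gq; exact: linear_rV_continuous.
have hu : (fun i => (h (c (u i) + 'd c (u i) v) - h (c (u i)) : R^o)) @ \oo -->
    (h (c x + 'd c x v) - h (c x) : R^o).
  apply: cvgB; last exact: continuous_cvg (@sublinear_continuous (c x)) cu.
  exact: continuous_cvg (@sublinear_continuous _) (cvgD cu dcu).
rewrite dotC; apply: ler_cvg_to gv hu _.
by apply: filterS mg => i /(_ v); rewrite dotC.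
Qed.

Lemma clarke_model_subgradient x q :
  `|x - x0| < r -> clarke f x q -> model_subgradient x q.
Proof.
(* The Clarke subdifferential is the smallest convex set containing the limiting gradients, so it
   suffices that model subgradients form such a set. *)
move=> xr; apply; split=> [|{}q [u [ux du gq]]].
  apply/convex_setE => p q' s /andP[s0 s1] Sp Sq v.
  rewrite dotDl !dotZl.
  have := ler_wpM2l s0 (Sp v).
  have s1' : 0 <= 1 - s by rewrite subr_ge0.
  have := ler_wpM2l s1' (Sq v).
  by lra.
have near_r := near_in_ball xr.
apply: (model_subgradient_closed ux gq); case: (ux _ near_r).
move=> N _ uN; exists N => // i /uN ur.
apply: upper_model_subgradient => // e e0.
apply: filterS (differentiable_eps (du i) e0) => y.
by rewrite dot_gradient ler_norml => /andP[_]; lra.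
Qed.

(** At a maximizer [f] lies below a quadratic touching it. The factor [t] of the penalty cancels the
    rescaling [x0 + t *: z], so the slope does not depend on [t]. *)
Lemma max_upper_gradient (t k : R) (w z : 'rV[R]_d) : 0 < t -> 0 < k ->
  `|z - w| < 1 ->
  (forall z', `|z' - w| <= 1 ->
    f (x0 + t *: z') - t * k * dot (z' - w) (z' - w) <=
    f (x0 + t *: z) - t * k * dot (z - w) (z - w)) ->
  upper_gradient (x0 + t *: z) ((2 * k) *: (z - w)).
Proof.
move=> t0 k0 zw zmax e e0; apply/nbhs_ballE.
have D0 : 0 < k * d%:R + 1 by rewrite ltr_wpDl // mulr_ge0 // ltW.
(* The first radius keeps the perturbed point in the unit ball around [w]; the second makes the
   quadratic term at most [e * |s|]. *)
exists (Num.min (t * (1 - `|z - w|)) (t * e / (k * d%:R + 1))).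
  by rewrite lt_min !mulr_gt0 ?subr_gt0 // invr_gt0.
move=> y; have [s sE] : exists s, s = y - (x0 + t *: z) by eexists.
rewrite -sE lt_min => /andP[s1 s2].
have yE : y = x0 + t *: (z + t^-1 *: s).
  by rewrite scalerDr scalerA mulfV ?gt_eqF // scale1r addrA sE subrKC.
have := zmax (z + t^-1 *: s); rewrite -yE addrAC.
move: (z - w) zw s1 => a zw s1 zmax'.
have {}zmax' := zmax' _.
have st : `|t^-1 *: s| = `|s| / t.
  by rewrite normrZ gtr0_norm ?invr_gt0 // mulrC.
have sd : dot s s <= d%:R * `|s| * `|s|.
  by apply: le_trans (ler_norm _) _; exact: dot_norm_le.
have {}zmax' : f y - t * k * dot (a + t^-1 *: s) (a + t^-1 *: s) <=
    f (x0 + t *: z) - t * k * dot a a.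
  apply: zmax'; apply: le_trans (ler_normD _ _) _; rewrite st.
  rewrite -lerBrDl ler_pdivrMr // mulrC; exact: ltW.
move: zmax'; rewrite dotDl !dotDr !dotZr !dotZl (dotC s a).
have -> : t * k * (dot a a + t^-1 * dot a s +
    (t^-1 * dot a s + t^-1 * (t^-1 * dot s s)))
    = t * k * dot a a + 2 * k * dot a s + k / t * dot s s.
  by field; rewrite gt_eqF.
have : k / t * dot s s <= e * `|s|.
  rewrite mulrAC ler_pdivrMr //.
  apply: (@le_trans _ _ (k * (d%:R * `|s| * `|s|))).
    by rewrite ler_wpM2l // ltW.
  have -> : k * (d%:R * `|s| * `|s|) = k * d%:R * `|s| * `|s| by ring.
  rewrite mulrAC [leRHS]mulrAC ler_wpM2r //.
  move: s2; rewrite ltr_pdivlMr // mulrDr mulr1 => s2.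
  by have := normr_ge0 s; rewrite mulrC [e * t]mulrC; lra.
by lra.
Qed.

Lemma gradient_near_direction (Lam : R) (w : 'rV[R]_d) : 0 <= Lam ->
  (forall x y, `|x - x0| < r -> `|y - x0| < r -> f x - f y <= Lam * `|x - y|) ->
  0 < h ('d c x0 w) ->
  exists N eta : R, 0 < eta /\
    forall e, 0 < e -> exists u, [/\ `|u - x0| < e,
      differentiable (f : _ -> R^o) u, `|gradient f u| <= N &
      eta <= dot (gradient f u) w].
Proof.
move=> Lam0 fL; set delta := h _ => delta0.
(* Steep enough for the maximizer [z] below to satisfy [`|z - w| <= Lam / k < 1]
   and [2 k |z - w|^2 <= delta / 4]. *)
pose k := Lam + 1 + 8 * Lam ^+ 2 / delta.
have k1 : Lam + 1 <= k.
  by rewrite lerDl mulr_ge0 ?invr_ge0 ?mulr_ge0 ?exprn_ge0 // ltW.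
have k0 : 0 < k by apply: lt_le_trans k1; rewrite ltr_wpDl.
have kdelta : 8 * Lam ^+ 2 <= k * delta.
  rewrite -ler_pdivrMr // /k lerDr; lra.
exists (2 * k), (delta / 2); split=> [|e e0]; first exact: divr_gt0.
pose W := `|w| + 1; have W0 : 0 < W by rewrite ltr_wpDl.
have er0 : 0 < Num.min e r by rewrite lt_min e0.
have [t [[t0 tW] tK]] : exists t, (0 < t /\ t * W < Num.min e r) /\
    t * (2 * H * K * W ^+ 2) < delta / 4.
  apply: (@filter_ex _ (0 : R)^'+); apply: filterI; last first.
    by apply: near0_small; exact: divr_gt0.
  by apply: filterI; [exact: nbhs_right_gt|exact: near0_small].
move: tW; rewrite lt_min => /andP[tWe tWr].
have normW z : `|z - w| <= 1 -> `|z| <= W.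
  move=> zw; rewrite -(subrK w z) addrC.
  by apply: le_trans (ler_normD _ _) _; rewrite lerD2l.
have xt z : `|x0 + t *: z - x0| = t * `|z|.
  by rewrite addrAC subrr add0r normrZ gtr0_norm.
have ball_r z : `|z - w| <= 1 -> `|x0 + t *: z - x0| < r.
  move=> /normW zW; rewrite xt; apply: le_lt_trans tWr.
  by rewrite ler_wpM2l // ltW.
pose Z := [set z : 'rV[R]_d | `|z - w| <= 1].
have ww : `|w - w| <= 1 by rewrite subrr normr0.
pose G z := f (x0 + t *: z) - t * k * dot (z - w) (z - w).
have [z /set_mem zZ zmax] : exists2 z, z \in Z & forall t, t \in Z -> G t <= G z.
  apply: EVT_max_rV; first by exists w.
    apply: bounded_closed_compact; last exact: closed_norm_ball.
    exists W; split=> [|M WM z /normW zW]; first exact: num_real.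
    exact: le_trans zW (ltW WM).
  apply: continuous_in_subspaceT => y /set_mem yZ.
  have fy : {for y, continuous (fun z => f (x0 + t *: z) : R^o)}.
    apply: continuous_eps => e' e'0.
    have ty : t * `|y| < r by rewrite -xt ball_r.
    have tL : 0 < t * (Lam + 1) by rewrite mulr_gt0 // ltr_wpDl.
    exists (Num.min (r / t - `|y|) (e' / (t * (Lam + 1)))).
      by rewrite lt_min divr_gt0 // subr_gt0 ltr_pdivlMr // mulrC ty.
    move=> z; rewrite lt_min => /andP[z1 z2].
    have zr : `|x0 + t *: z - x0| < r.
      rewrite xt -(subrK y z).
      have zy := ler_normD (z - y) y.
      have : `|z - y + y| < r / t by apply: le_lt_trans zy _; rewrite -ltrBrDr.
      by rewrite ltr_pdivlMr // mulrC.
    have Lz : Lam * (t * `|z - y|) < e'.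
      apply: (@le_lt_trans _ _ (`|z - y| * (t * (Lam + 1)))).
        have : 0 <= t * `|z - y| by rewrite mulr_ge0 // ltW.
        by lra.
      by rewrite -ltr_pdivlMr.
    have zyE : x0 + t *: z - (x0 + t *: y) = t *: (z - y).
      by rewrite opprD addrACA subrr add0r -scalerBr.
    have := fL _ _ zr (ball_r y yZ); have := fL _ _ (ball_r y yZ) zr.
    rewrite (distrC (x0 + t *: y)) zyE normrZ gtr0_norm // => fL1 fL2.
    by apply: le_lt_trans Lz; rewrite ler_norml; apply/andP; split; lra.
  have dy : {for y, continuous (fun z => t * k * dot (z - w) (z - w) : R^o)}.
    apply: (@continuousM R _ (cst (t * k)) (fun z => dot (z - w) (z - w))).
      exact: cst_continuous.
    exact: dot_self_continuous.
  exact: (continuousB fy dy).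
have {}zmax z' : `|z' - w| <= 1 -> G z' <= G z by move=> z'Z; apply/zmax/mem_set.
pose a := z - w.
(* The penalty vanishes at [w], so maximality and the Lipschitz bound control the penalty at [z]. *)
have adot : k * dot a a <= Lam * `|a|.
  have := zmax w ww; rewrite /G subrr dot0l mulr0 subr0 => fwz.
  rewrite -(ler_pM2l t0); have := fL _ _ (ball_r z zZ) (ball_r w ww).
  have -> : x0 + t *: z - (x0 + t *: w) = t *: a.
    by rewrite opprD addrACA subrr add0r -scalerBr.
  by rewrite normrZ gtr0_norm // -/a in fwz *; lra.
have ka : k * `|a| <= Lam.
  have [->|a_neq0] := eqVneq a 0; first by rewrite normr0 mulr0.
  have a0 : 0 < `|a| by rewrite normr_gt0.
  rewrite -(ler_pM2r a0) -mulrA -expr2; apply: le_trans adot.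
  by rewrite ler_wpM2l ?norm_sqr_le_dot // ltW.
have a1 : `|a| < 1.
  have : k * `|a| < k * 1 by rewrite mulr1; apply: le_lt_trans ka _; lra.
  by rewrite ltr_pM2l.
have dot_small : 2 * k * dot a a <= delta / 4.
  have : k * (k * dot a a) <= k * delta / 8.
    apply: (@le_trans _ _ (Lam ^+ 2)); last by lra.
    apply: (@le_trans _ _ (Lam * (k * `|a|))).
      by rewrite [leRHS]mulrCA ler_wpM2l // ltW.
    by rewrite expr2 ler_wpM2l.
  by rewrite -mulrA ler_pM2l //; lra.
pose u := x0 + t *: z; pose p := (2 * k) *: a.
have up : upper_gradient u p by exact: max_upper_gradient.
have ur : `|u - x0| < r := ball_r z zZ.
have mp := upper_model_subgradient ur up.
have [du gu] := model_subgradient_diff ur up mp.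
exists u; rewrite gu; split=> //.
- by rewrite xt; apply: le_lt_trans tWe; rewrite ler_wpM2l ?normW // ltW.
- rewrite normrZ gtr0_norm ?mulr_gt0 // ler_piMr ?(ltW a1) //.
  by rewrite mulr_ge0 // ltW.
have x0r : `|x0 - x0| < r by rewrite subrr normr0.
(* The subgradient inequality from [u] back to [x0] bounds [t * dot p z] below by [f u - f x0],
   maximality bounds this by [f (x0 + t *: w) - f x0], and Taylor expansion at [x0] by [t * delta],
   each up to [t ^+ 2] terms. Passing from [z] to [w] costs [2 * k * dot a a <= delta / 4]. *)
have uz : u + - (t *: z) = x0 by rewrite addrK.
have := model_le ur (v := - (t *: z)); rewrite uz => /(_ x0r).
rewrite cx0 sublinear0 // normrN normrZ gtr0_norm // => hu.
have := mp (- (t *: z)); rewrite dotNr dotZr => mpz.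
have := model_le x0r (ball_r w ww).
rewrite cx0 add0r normrZ gtr0_norm // linearZ /= sublinearZ // -/delta => hw.
have := zmax w ww; rewrite /G subrr dot0l mulr0 subr0 -/a -/u.
rewrite (fE ur) (fE (ball_r w ww)) => fwz.
have zW : `|z| ^+ 2 <= W ^+ 2 by rewrite ler_pXn2r ?nnegrE ?normW // ltW.
have wW : `|w| ^+ 2 <= W ^+ 2 by rewrite ler_pXn2r ?nnegrE ?normW // ltW.
have tda : 0 <= t * k * dot a a by rewrite !mulr_ge0 ?dot_ge0 // ltW.
have HK0 : 0 <= H * K * t ^+ 2 by rewrite !mulr_ge0 ?exprn_ge0 // ltW.
have e1 := ler_wpM2l HK0 zW; have e2 := ler_wpM2l HK0 wW.
have e3 : t * (t * (2 * H * K * W ^+ 2)) <= t * (delta / 4).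
  by rewrite ler_wpM2l // ltW.
have e4 : t * (delta - delta / 4) <= t * dot p z.
  move: hu mpz hw fwz e1 e2 e3 tda; rewrite !exprMn.
  by move: (dot a a) (dot p z) => daa dpz; lra.
have pw : dot p w = dot p z - 2 * k * dot a a.
  by rewrite -[w](subKr z) -/a dotBr /p dotZl [dot (_ *: _) a]dotZl.
by move: e4; rewrite ler_pM2l // pw; lra.
Qed.

Lemma ri_sharp v : relative_interior (clarke f x0) 0 ->
  (forall w, 0 < h ('d c x0 w) -> exists2 q, clarke f x0 q & 0 < dot q w) ->
  ~ Lin h ('d c x0 v) -> 0 < h ('d c x0 v).
Proof.
move=> [cl0 /nbhs_ballE[s s0 ri]] ex nL; rewrite ltNge; apply/negP => hv.
(* The sum of the values of [h] at opposite vectors is nonnegative; were [h] zero at the opposite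
   vector, both values would vanish and the vector would lie in [Lin h]. *)
have hNv : 0 < h ('d c x0 (- v)).
  rewrite linearN /=.
  have hNge := sublinearN_ge h_sub ('d c x0 v).
  rewrite lt_def; apply/andP; split; last by lra.
  apply/eqP => hN0; apply: nL; apply/LinP; rewrite hN0.
  by apply/eqP; rewrite eq_sym oppr_eq0 eq_le hv /=; lra.
have [q qcl qv] := ex _ hNv.
have [t [t0 tq]] : exists t, 0 < t /\ t * `|q| < s.
  apply: (@filter_ex _ (0 : R)^'+); apply: filterI; last exact: near0_small.
  exact: nbhs_right_gt.
(* The point is an affine combination of [q] and 0, hence in the affine hull, and it is close enough
   to 0 for the relative interior condition. *)
have clq : clarke f x0 (- t *: q).
  apply: ri; first by rewrite subr0 normrZ normrN gtr0_norm.
  move=> A [affA /= subA].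
  have -> : - t *: q = - t *: q + (1 - - t) *: 0 by rewrite scaler0 addr0.
  by apply: affA; exact: subA.
have x0r : `|x0 - x0| < r by rewrite subrr normr0.
have := clarke_model_subgradient x0r clq v.
rewrite cx0 add0r sublinear0 // subr0 dotZl.
move: qv; rewrite dotNr oppr_gt0 => qv.
have : 0 < - t * dot q v by rewrite nmulr_rgt0 ?oppr_lt0.
by lra.
Qed.

(** * The active manifold, its tangent spaces and covariant gradients *)

Section Manifold.
Variables (k : nat) (P : 'M[R]_(m, k)) (l : 'rV[R]_m) (B : 'M[R]_(k, d)).
Hypotheses (LP : forall z, Lin h z <-> z *m P = 0)
  (hl : forall z, Lin h z -> h z = dot l z)
  (dcB : forall z, 'd c x0 (z *m B) *m P = z).

Let F x := c x *m P.
Let M := [set x | F x = 0].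

Lemma diff_F x v : 'd F x v = 'd c x v *m P.
Proof.
have dg : is_diff (c x) (mulmxr P) (mulmxr P).
  apply: DiffDef; first exact/linear_differentiable/linear_rV_continuous.
  exact/diff_lin/linear_rV_continuous.
have [dc _] := cC2; have dcx := differentiableP (dc x I).
by have dF := is_diff_comp dcx dg; rewrite diff_val.
Qed.

(** At [x0] the map [z |-> 'd F x0 (z *m B)] is the identity; the Lipschitz bound on ['d c] keeps it
    within 1/2 of the identity nearby. *)
Lemma F_surjective : exists2 r1 : R, 0 < r1 &
  forall x, `|x - x0| < r1 -> forall y, exists z, 'd c x (z *m B) *m P = y.
Proof.
have [a a0 aP] := mulmx_norm_le P; have [b b0 bB] := mulmx_norm_le B.
have akb : 0 < 2 * a * K * b by rewrite !mulr_gt0.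
exists (Num.min r (2 * a * K * b)^-1); first by rewrite lt_min r0 invr_gt0.
move=> x; rewrite lt_min => /andP[xr xab].
pose g := mulmxr P \o 'd c x \o mulmxr B.
apply: (@near_identity_surjective R k g) => z.
have gE : g z - z = ('d c x (z *m B) - 'd c x0 (z *m B)) *m P.
  rewrite mulmxBl; exact: (congr1 (fun y => g z - y) (esym (dcB z))).
have x0r : `|x0 - x0| < r by rewrite subrr normr0.
rewrite gE; apply: le_trans (aP _) _.
apply: (@le_trans _ _ (a * (K * `|x - x0| * (b * `|z|)))).
  rewrite ler_wpM2l ?(ltW a0) //; apply: le_trans (dcL _ xr x0r) _.
  by rewrite ler_wpM2l // mulr_ge0 // ltW.
rewrite !mulrA ler_wpM2r //; move: xab; rewrite -[_^-1]mul1r ltr_pdivlMr //.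
by lra.
Qed.

(** A Newton step [v = z *m B] sends the linearization of [c] into [Lin h], where [h] splits
    additively. Hence [- dot q v >= h (- 'd c x v)], at least a multiple of [|z|], while
    [|v| <= b * |z|]; so [q] cannot be small. *)
Lemma sharp_off_manifold :
  (forall v, ~ Lin h ('d c x0 v) -> 0 < h ('d c x0 v)) ->
  exists2 r2 : R, 0 < r2 & exists2 eta : R, 0 < eta &
    forall x q, `|x - x0| < r2 -> F x != 0 -> model_subgradient x q ->
      eta <= enorm q.
Proof.
move=> hpos; have [b b0 bB] := mulmx_norm_le B.
have [r1 r1_gt0 surj] := F_surjective.
pose g z := h ('d c x0 (z *m B)).
have [||||e e0 ge] := @homogeneous_lower_bound R k g.
- move=> z; apply: (@continuous_comp _ _ _ ('d c x0 \o mulmxr B) h).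
    exact: linear_rV_continuous.
  exact: sublinear_continuous.
- move=> t z t0; rewrite /g -scalemxAl linearZ /=; exact: sublinearZ.
- by rewrite /g mul0mx linear0; exact: sublinear0.
- move=> z z0; apply: hpos => /LP; rewrite (dcB z); exact/eqP.
(* Within [r3], replacing ['d c x] by ['d c x0] costs at most half of the bound [e * |z|]. *)
pose r3 := e / (2 * H * K * b).
have HKb : 0 < 2 * H * K * b by rewrite !mulr_gt0.
have small s : s < r3 -> H * K * s * b <= e / 2.
  by rewrite /r3 ltr_pdivlMr //; lra.
have combine (a1 a2 a3 a4 p D z : R) : p <= a1 - (a2 + a1) -> a3 - a2 <= a4 ->
    e * z <= a3 -> a4 <= e / 2 * z -> - p <= D -> e / 2 * z <= D by lra.
exists (Num.min r (Num.min r1 r3)); first by rewrite !lt_min r0 r1_gt0 divr_gt0.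
pose D := 2 * (d%:R * b + 1); have D0 : 0 < D.
  by rewrite mulr_gt0 // ltr_wpDl // mulr_ge0 // ltW.
exists (e / D) => [|x q]; first exact: divr_gt0.
rewrite !lt_min => /and3P[xr xr1 xr3] Fx mq.
have [z zE] := surj x xr1 (- F x).
have z0 : z != 0.
  apply: contraNneq Fx => z0; rewrite -oppr_eq0 -zE z0.
  by rewrite mul0mx linear0 mul0mx.
pose v := z *m B.
have Lb : Lin h (c x + 'd c x v) by apply/LP; rewrite mulmxDl zE subrr.
have cxE : c x = 'd c x (- v) + (c x + 'd c x v).
  by rewrite linearN addrCA addNr addr0.
have := mq v; rewrite [in X in _ - X]cxE (sublinear_LinD h_sub _ Lb) => qv.
have x0r : `|x0 - x0| < r by rewrite subrr normr0.
have hx : h ('d c x0 (- v)) - h ('d c x (- v)) <= H * (K * `|x - x0| * `|v|).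
  apply: le_trans (hL _ _) _; rewrite ler_wpM2l ?(ltW H0) // distrC.
  by apply: le_trans (dcL _ xr x0r) _; rewrite normrN.
have gz : e * `|z| <= h ('d c x0 (- v)).
  by have := ge (- z); rewrite /g normrN mulNmx.
have nz : 0 < `|z| by rewrite normr_gt0.
have e2 : H * (K * `|x - x0| * `|v|) <= e / 2 * `|z|.
  apply: (@le_trans _ _ (H * (K * `|x - x0| * (b * `|z|)))).
    apply: ler_wpM2l (ltW H0) _ _ _; apply: ler_wpM2l (bB z).
    by rewrite mulr_ge0 // ltW.
  by rewrite !mulrA ler_wpM2r // small.
have dqv : - dot q v <= d%:R * `|q| * (b * `|z|).
  apply: le_trans (ler_norm _) _; rewrite normrN.
  apply: le_trans (dot_norm_le q v) _; apply: ler_wpM2l (bB z).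
  by rewrite mulr_ge0.
have := combine _ _ _ _ _ _ _ qv hx gz e2 dqv.
rewrite mulrA ler_pM2r // ler_pdivrMr // => {qv hx gz e2 dqv} e3.
rewrite ler_pdivrMr //; apply: le_trans e3 _.
rewrite (_ : _ * 2 = 2 * (d%:R * b * `|q|)); last by ring.
rewrite (_ : enorm q * D = 2 * ((d%:R * b + 1) * enorm q)); last first.
  by rewrite /D; ring.
rewrite ler_pM2l //; apply: (@le_trans _ _ (d%:R * b * enorm q)).
  by rewrite ler_wpM2l ?norm_le_enorm // mulr_ge0 // ltW.
by rewrite ler_wpM2r ?enorm_ge0 // lerDl.
Qed.

Let U r1 := [set x : 'rV[R]_d | `|x - x0| < r1].

Lemma open_U r1 : open (U r1).
Proof.
rewrite openE => x /= Ux; suff : \forall y \near x, U r1 y by [].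
exact: near_in_ball.
Qed.

Hypothesis cC4 : Cp 4 setT c.
Variable r1 : R.
Hypotheses (r1_gt0 : 0 < r1) (r1r : r1 <= r)
  (surj : forall x, `|x - x0| < r1 ->
     forall y, exists z, 'd c x (z *m B) *m P = y).

Lemma defining_F y : U r1 y -> defining_map 4 M y (U r1) F.
Proof.
move=> Uy; split=> //.
- exact: open_U.
- have FE : forall x, U r1 x -> 0 + mulmxr P (c x) = F x.
    by move=> x _; rewrite add0r.
  refine (@Cp_ext R d _ 4 (U r1) (fun x => 0 + mulmxr P (c x)) F
    (@open_U r1) FE _).
  exact: (Cp_linear_comp (mulmxr P) 0 (@open_U r1) (Cp_sub (@subsetT _ _) cC4)).
- move=> x Ux; apply/seteqP; split=> // z _.
  have [w wE] := surj Ux z; exists (w *m B) => //.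
  by rewrite diff_F.
- by apply/seteqP; split=> x [].
Qed.

(** [tangent_space] ranges over all defining maps [G]. As [F] vanishes where [G] does,
    [tangent_diff0] puts each kernel inside that of ['d F y]. *)
Lemma tangent_spaceE y v : U r1 y -> M y ->
  tangent_space 4 M y v <-> 'd c y v *m P = 0.
Proof.
move=> Uy My; rewrite -diff_F; split=> [[m' [V [G [[oV Vy CG dGT MV] dGv]]]]|dFv].
  have Gy : G y = 0.
    by have : [set y | V y /\ G y = 0] y; [rewrite -MV|case].
  have [_ _ CF _ _] := defining_F Uy.
  apply: (tangent_diff0 oV Vy (CpW _ CG) Gy (dGT y Vy) dGv) => //.
    by case: CF => dF _; exact: dF.
  apply: filterS (open_nbhs_nbhs (conj oV Vy)) => x Vx Gx.
  have : [set y | V y /\ G y = 0] x by [].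
  by rewrite -MV => -[].
by exists k, (U r1), F; split=> //; exact: defining_F.
Qed.

(** On [M] the value [h (c y)] is [dot l (c y)]; the linear form makes the extension as smooth as
    [c]. *)
Let fhat y : R^o := f x0 + dot l (c y).

Lemma extension_fhat y : U r1 y -> smooth_extension 4 M f y (U r1) fhat.
Proof.
move=> Uy; split=> //; first exact: open_U.
  exact: (@Cp_linear_comp R d m R^o 4 (U r1) c (dot l) (f x0) (@open_U r1)
    (Cp_sub (@subsetT _ _) cC4)).
move=> z Mz Uz; rewrite fE; last exact: lt_le_trans Uz r1r.
by rewrite /fhat hl //; apply/LP.
Qed.

Lemma diff_fhat y v : differentiable fhat y /\ 'd fhat y v = dot l ('d c y v).
Proof.
have dg : is_diff (c y) (dot l : _ -> R^o) (dot l).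
  apply: DiffDef; first exact/linear_differentiable/linear_rV_continuous.
  exact/diff_lin/linear_rV_continuous.
have [dc _] := cC2; have dcx := differentiableP (dc y I).
have : is_diff y (cst (f x0 : R^o) + (dot l \o c)) (0 + (dot l \o 'd c y)).
  exact: is_diffD (is_diff_comp dcx dg).
rewrite add0r => dF.
by split; [exact: (@ex_diff _ _ _ _ _ _ _ dF)|
           rewrite (@diff_val _ _ _ _ _ _ _ dF)].
Qed.

Lemma orth_proj_tangent y u (T := tangent_space 4 M y) : U r1 y -> M y ->
  T (orth_proj T u) /\ forall w, T w -> dot (u - orth_proj T u) w = 0.
Proof.
move=> Uy My; apply: (@orth_proj_kernel R d k (lin1_mx ('d F y))) => w.
by rewrite mul_rV_lin1 /= diff_F; exact: tangent_spaceE.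
Qed.

(** The gradient comes from an unknown extension [fh] chosen by [get]; [fh - fhat] vanishes on [M],
    so both have the same differential on tangent vectors. *)
Lemma dot_covariant_gradient y w : U r1 y -> M y -> tangent_space 4 M y w ->
  dot (covariant_gradient 4 M f y) w = dot l ('d c y w).
Proof.
move=> Uy My Tw; set T := tangent_space 4 M y in Tw *.
pose Q := [set g | exists V fh, smooth_extension 4 M f y V fh /\
  g = orth_proj T (gradient fh y)].
have exQ : exists g, Q g.
  by eexists; exists (U r1), fhat; split; first exact: extension_fhat.
have [V [fh [[oV Vy Cfh ffh] gE]]] : Q (covariant_gradient 4 M f y).
  exact: (@getPex _ Q exQ).
have [_ /(_ w Tw)] := orth_proj_tangent (gradient fh y) Uy My.
rewrite -/T -gE dotBl dot_gradient => /eqP; rewrite subr_eq0 => /eqP <-.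
have [oU _ CF dFT _] := defining_F Uy.
have dFw : 'd F y w = 0 by rewrite diff_F; apply/tangent_spaceE.
have [dfh _] := Cfh; have dfhy := dfh y Vy.
have [dfhat dfhatE] := diff_fhat y w.
have : 'd (fh - fhat) y w = 0.
  apply: (tangent_diff0 oU Uy (CpW _ CF) My (dFT y Uy) dFw) => //.
    exact: differentiableB.
  apply: filterS2 (open_nbhs_nbhs (conj oV Vy)) (open_nbhs_nbhs (conj oU Uy)).
  move=> x Vx Ux Mx; have [_ _ _ ffhat] := extension_fhat Uy.
  suff : fh x - fhat x = 0 by [].
  by rewrite -(ffh x Mx Vx) (ffhat x Mx Ux) subrr.
rewrite -dfhatE => psi0; apply/eqP; rewrite -subr_eq0 -psi0.
by apply/eqP; have /(congr1 (fun g => g w)) := diffB dfhy dfhat.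
Qed.

(** For the projection [p] of [q - g], orthogonality gives [dot p p = dot q p - dot g p]. Here
    [dot q p <= h ('d c x p)] and [dot g p = h ('d c y p)], so the Lipschitz bounds on [h] and
    ['d c] finish after cancelling [enorm p]. *)
Lemma composite_strong_a : strong_a 4 M f x0.
Proof.
exists (H * K); first exact: mulr_gt0.
have nearU : \forall x \near x0, U r1 x by apply/nbhs_ballE; exists r1.
have combine (a b e1 e2 s D : R) :
    a <= b - e1 -> b <= e1 + e2 -> e2 - s <= D -> a - s <= D by lra.
exists (U r1, U r1) => // -[x y] [/= Ux Uy] q qcl My.
set T := tangent_space 4 M y; set g := covariant_gradient _ _ _ _.
have xr : `|x - x0| < r := lt_le_trans Ux r1r.
have yr : `|y - x0| < r := lt_le_trans Uy r1r.
have [] := orth_proj_tangent (q - g) Uy My; rewrite -/T.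
set p := orth_proj _ _ => Tp /(_ p Tp); rewrite dotBl => /eqP.
rewrite subr_eq0 => /eqP pp.
have Lp : Lin h ('d c y p) by apply/LP/tangent_spaceE.
have := clarke_model_subgradient xr qcl p => qp.
have hD := sublinearD h_sub (c x) ('d c x p).
have hdc : h ('d c x p) - h ('d c y p) <= H * (K * `|x - y| * `|p|).
  by apply: le_trans (hL _ _) _; rewrite ler_wpM2l ?(ltW H0) // dcL.
have : enorm p ^+ 2 <= H * K * enorm (x - y) * enorm p.
  apply: (@le_trans _ _ (H * (K * `|x - y| * `|p|))).
    have gp : dot g p = h ('d c y p).
      by rewrite (hl Lp); exact: dot_covariant_gradient.
    by rewrite sqr_enorm -pp dotBl gp; exact: combine qp hD hdc.
  rewrite !mulrA; apply: ler_pM; rewrite ?norm_le_enorm ?mulr_ge0 //.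
  - exact: ltW.
  - exact: ltW.
  by rewrite ler_wpM2l ?norm_le_enorm // mulr_ge0 // ltW.
have [->|p0] := eqVneq (enorm p) 0.
  by rewrite !mulr_ge0 ?enorm_ge0 // ltW.
by rewrite expr2 ler_pM2r // lt_def p0 enorm_ge0.
Qed.

Lemma composite_b_le_regular : b_le_regular M f x0.
Proof.
(* The remainder is the Taylor error of [model_le], taken at the displacement [y - x]. *)
exists (fun t => - (H * K * t ^+ 2)).
  rewrite (_ : (fun t => _) = *%R (- (H * K))); last first.
    (* At [t = 0] both sides are 0 because the inverse of 0 is 0. *)
    apply/funext => t; have [->|t0] := eqVneq t 0.
      by rewrite invr0 !mulr0.
    by field.
  rewrite -[X in _ --> X](mulr0 (- (H * K))).
  apply: cvg_trans (@mulrl_continuous R (- (H * K)) 0).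
  by apply: cvg_app; exact: cvg_within.
have nearU : \forall x \near x0, U r1 x by apply/nbhs_ballE; exists r1.
exists (U r1, U r1) => // -[x y] [/= Ux Uy] q qcl _.
have xr : `|x - x0| < r := lt_le_trans Ux r1r.
have yr : `|y - x0| < r := lt_le_trans Uy r1r.
have := clarke_model_subgradient xr qcl (y - x) => qyx.
have := @model_le x (y - x) xr; rewrite subrKC => /(_ yr) hyx.
have : H * K * `|y - x| ^+ 2 <= H * K * enorm (y - x) ^+ 2.
  rewrite ler_wpM2l ?mulr_ge0 ?(ltW H0) ?(ltW K0) //.
  by rewrite sqr_enorm norm_sqr_le_dot.
by rewrite (fE xr) (fE yr); lra.
Qed.

Lemma composite_active_manifold (r2 eta : R) : clarke f x0 0 ->
  0 < r2 -> 0 < eta ->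
  (forall x q, `|x - x0| < r2 -> F x != 0 -> model_subgradient x q ->
      eta <= enorm q) ->
  active_manifold 4 M f x0.
Proof.
move=> cl0 r2_gt0 eta0 sharp; have Ux0 : U r1 x0 by rewrite /U /= subrr normr0.
split=> //.
- by rewrite /M /= /F cx0 mul0mx.
- by exists k, (U r1), F; exact: defining_F.
- by exists (U r1), fhat; exact: extension_fhat.
exists [set x | `|x - x0| < Num.min r r2].
  suff : \forall x \near x0, `|x - x0| < Num.min r r2 by [].
  by apply/nbhs_ballE; exists (Num.min r r2); rewrite ?lt_min ?r0.
apply: (@lt_le_trans _ _ eta%:E); first by rewrite lte_fin.
apply/ereal_infP => _ [q [x [/= + Mx] qcl] <-]; rewrite lt_min => /andP[xr xr2].
rewrite lee_fin; apply: (sharp x) => //; first exact/eqP.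
exact: clarke_model_subgradient.
Qed.

End Manifold.

End Composite.

Theorem theorem3p3 (R : realType) (d : nat) (f : 'rV[R]_d -> R)
    (xbar : 'rV[R]_d)
    (f_lip : locally_lipschitz (f : 'rV[R]_d -> R^o))
    (f_min : local_minimizer f xbar)
    (f_dec : properly_decomposable 4 f xbar)
    (strict_complementarity : relative_interior (clarke f xbar) 0)
    (growth : quadratic_growth f xbar) :
  typical f xbar.
Proof.
split=> //; have [m [c [h [cC4 cx0 h_sub fnear LinT]]]] := f_dec.
have [H H0 hL] := sublinear_lipschitz h_sub.
have cC2 : Cp 2 setT c by exact: CpW cC4.
have [K [rc [K0 rc0 _ dcL cT]]] := Cp2_taylor openT I cC2 (x0 := xbar).
have /nbhs_ballE[rf rf0 fE] := fnear.
have [Lam [rL [Lam0 rL0 fL]]] := locally_lipschitz_bound xbar f_lip.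
pose r := Num.min rc (Num.min rf rL).
have r0 : 0 < r by rewrite !lt_min rc0 rf0.
have rP (x : 'rV[R]_d) : `|x - xbar| < r ->
    [/\ `|x - xbar| < rc, `|x - xbar| < rf & `|x - xbar| < rL].
  by rewrite !lt_min => /and3P[].
have dcL' x y v : `|x - xbar| < r -> `|y - xbar| < r ->
    `|'d c x v - 'd c y v| <= K * `|x - y| * `|v|.
  by move=> /rP[xr _ _] /rP[yr _ _]; exact: dcL.
have cT' x y : `|x - xbar| < r -> `|y - xbar| < r ->
    `|c y - c x - 'd c x (y - x)| <= K * `|y - x| ^+ 2.
  by move=> /rP[xr _ _] /rP[yr _ _]; exact: cT.
have fE' y : `|y - xbar| < r -> f y = f xbar + h (c y).
  by move=> /rP[_ yr _]; exact: fE.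
have fL' x y : `|x - xbar| < r -> `|y - xbar| < r -> f x - f y <= Lam * `|x - y|.
  move=> /rP[_ _ xr] /rP[_ _ yr].
  exact: le_trans (ler_norm _) (fL _ _ xr yr).
have sharp v : ~ Lin h ('d c xbar v) -> 0 < h ('d c xbar v).
  apply: (ri_sharp h_sub H0 hL cC2 cx0 r0 cT' fE') => // w hw.
  have [N [eta [eta0 ex]]] :=
    gradient_near_direction h_sub H0 hL cx0 K0 r0 cT' fE' Lam0 fL' hw.
  have [q qlim qw] := limiting_gradients_compact ex.
  exists q; last exact: lt_le_trans qw.
  exact: sub_gen_smallest.
have [k [P [l [Pfull LP hl]]]] := Lin_kernel h_sub.
(* [P] annihilates [Lin h], so by transversality the range of ['d c xbar] alone already maps onto
   the whole quotient. *)
have [B dcB] : exists B : 'M[R]_(k, d), forall z, 'd c xbar (z *m B) *m P = z.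
  apply: (@linear_right_inverse R d k (mulmxr P \o 'd c xbar)).
  apply/seteqP; split=> // z _.
  have [u Lu [w [v _ vw] uwz]] :
      [set u + w | u in Lin h & w in range ('d c xbar)] (z *m pinvmx P).
    by rewrite LinT.
  exists v => //=; rewrite vw.
  have -> : w = z *m pinvmx P - u by rewrite -uwz addrC addKr.
  by rewrite mulmxBl (LP u).1 // subr0 mulmxKpV // submx_full.
have [r1 r1_gt0 surj] := F_surjective K0 r0 dcL' dcB.
pose r2 := Num.min r r1.
have r2_gt0 : 0 < r2 by rewrite lt_min r0.
have r2r : r2 <= r by rewrite ge_min lexx.
have surj2 x : `|x - xbar| < r2 ->
    forall y, exists z, 'd c x (z *m B) *m P = y.
  by rewrite lt_min => /andP[_ /surj].
have [r3 r3_gt0 [eta eta0 off]] :=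
  sharp_off_manifold h_sub H0 hL K0 r0 dcL' LP dcB sharp.
exists [set x | c x *m P = 0]; split.
- exact: (composite_active_manifold h_sub H0 hL cC2 cx0 r0 cT' fE' LP hl
    cC4 r2_gt0 r2r surj2 strict_complementarity.1 r3_gt0 eta0 off).
- exact: (composite_strong_a h_sub H0 hL cC2 K0 dcL' cT' fE' LP hl cC4
    r2_gt0 r2r surj2).
- exact: (composite_b_le_regular h_sub H0 hL cC2 K0 cT' fE' P r2_gt0 r2r).
Qed.
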